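(* Let $k$ be a field, $f_1,\dots,f_n\in(x,y)\subseteq k[[x,y]]$ prime elements, $f=f_1\cdots f_n$, $R=k[[x,y,u,v]]/(f-uv)$. Let $\mathcal{F}=(I_1,\dots,I_m)$ be a flag in $\{1,\dots,n\}$ with $m\ge1$, and put $g_1:=f_{I_1}$, $g_j:=f_{I_j}/f_{I_{j-1}}$ for $2\le j\le m$, and $g_{m+1}:=f/f_{I_m}$. Then the quiver of $\mathrm{End}_R(T^{\mathcal{F}})$ has vertices $R,T_{I_1},\dots,T_{I_m}$ and the following arrows (each labelled by the element of the fraction field of $R$ by which the corresponding homomorphism multiplies, ''inc'' denoting an inclusion). If $m\ge2$: arrows $R\xrightarrow{g_1}T_{I_1}$ and $T_{I_1}\xrightarrow{\mathrm{inc}}R$; arrows $T_{I_{j-1}}\xrightarrow{g_j}T_{I_j}$ and $T_{I_j}\xrightarrow{\mathrm{inc}}T_{I_{j-1}}$ for $2\le j\le m$; arrows $T_{I_m}\xrightarrow{g_{m+1}/u}R$ and $R\xrightarrow{u}T_{I_m}$. If $m=1$: two arrows $R\to T_{I_1}$, labelled $g_1$ and $u$, and two arrows $T_{I_1}\to R$, labelled $g_2/u$ and $\mathrm{inc}$. In addition there are possibly loops, given by the following rules. (i) At vertex $R$: if $(g_1,g_{m+1})=(x,y)$ in $k[[x,y]]$, there are no loops. If $(g_1,g_{m+1})\subsetneq(x,y)$ and there exists $t\in(x,y)$ with $(g_1,g_{m+1},t)=(x,y)$, there is one loop, labelled $t$. If there exists no such $t$, there are two loops, labelled $x$ and $y$.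 (ii) At vertex $T_{I_i}$ ($1\le i\le m$): if $(g_i,g_{i+1})=(x,y)$ in $k[[x,y]]$, there are no loops. If $(g_i,g_{i+1})\subsetneq(x,y)$ and there exists $t\in(x,y)$ with $(g_i,g_{i+1},t)=(x,y)$, there is one loop, labelled $t$. If there exists no such $t$, there are two loops, labelled $x$ and $y$.
   Context: A flag in $\{1,\dots,n\}$ is a chain $\mathcal{F}=(I_1,\dots,I_m)$ of subsets $\emptyset\subsetneq I_1\subsetneq\cdots\subsetneq I_m\subsetneq\{1,\dots,n\}$. For $I\subseteq\{1,\dots,n\}$, $f_I:=\prod_{i\in I}f_i$, $T_I:=(u,f_I)$ is an ideal of $R$, and $T^{\mathcal{F}}:=R\oplus\bigoplus_{j=1}^mT_{I_j}$. The quiver of $\mathrm{End}_R(T^{\mathcal{F}})$ has the indecomposable summands of $T^{\mathcal{F}}$ as vertices, and its arrows from $A$ to $B$ correspond to homomorphisms $A\to B$ forming a $k$-basis of $\mathrm{rad}(A,B)/\mathrm{rad}^2(A,B)$ in the category $\mathrm{add}\,T^{\mathcal{F}}$. Composition and paths are read from left to right ($ab$ means $a$ then $b$). *)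

(* Defs.v *)
From HB Require Import structures.
From mathcomp Require Import all_boot all_order all_algebra.
From mathcomp Require Import boolp.

Set Implicit Arguments.
Unset Strict Implicit.
Unset Printing Implicit Defensive.

Import GRing.Theory.
Local Open Scope ring_scope.
Local Open Scope quotient_scope.

(* Univariate formal power series A[[X]], as coefficient sequences.           *)

Record fps (A : Type) := FPS { fps_coef :> nat -> A }.

HB.instance Definition _ (A : Type) := gen_eqMixin (fps A).
HB.instance Definition _ (A : Type) := gen_choiceMixin (fps A).

Lemma fpsP (A : Type) (p q : fps A) : p =1 q -> p = q.
Proof. by case: p q => [p] [q] /= /funext->. Qed.

Section FpsRing.
Variable A : comNzRingType.
Implicit Types p q r : fps A.

Definition fpsC (a : A) : fps A := FPS (fun n => if n is 0%N then a else 0).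
Definition fpsX : fps A := FPS (fun n => (n == 1%N)%:R).

Definition fps_add p q : fps A := FPS (fun n => p n + q n).
Definition fps_opp p : fps A := FPS (fun n => - p n).
Definition fps_mul p q : fps A :=
  FPS (fun n => \sum_(i < n.+1) p i * q (n - i)%N).

Fact fps_addA : associative fps_add.
Proof. by move=> p q r; apply: fpsP => n /=; rewrite addrA. Qed.
Fact fps_addC : commutative fps_add.
Proof. by move=> p q; apply: fpsP => n /=; rewrite addrC. Qed.
Fact fps_add0 : left_id (fpsC 0) fps_add.
Proof. by move=> p; apply: fpsP => -[|n] /=; rewrite add0r. Qed.
Fact fps_addN : left_inverse (fpsC 0) fps_opp fps_add.
Proof. by move=> p; apply: fpsP => -[|n] /=; rewrite addNr. Qed.

HB.instance Definition _ :=
  GRing.isZmodule.Build (fps A) fps_addA fps_addC fps_add0 fps_addN.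

Definition fps_trunc N p : {poly A} := \poly_(i < N) p i.

Lemma fps_mul_trunc N p q n : (n < N)%N ->
  fps_mul p q n = (fps_trunc N p * fps_trunc N q)`_n.
Proof.
move=> ltnN; rewrite coefM /=; apply: eq_bigr => i _.
have lein : (i <= n)%N by rewrite -ltnS.
rewrite !coef_poly (leq_ltn_trans lein ltnN).
by rewrite (leq_ltn_trans (leq_subr i n) ltnN).
Qed.

Fact fps_mulC : commutative fps_mul.
Proof.
by move=> p q; apply: fpsP => n; rewrite !(@fps_mul_trunc n.+1) // mulrC.
Qed.

Fact fps_mulA : associative fps_mul.
Proof.
move=> p q r; apply: fpsP => n.
set P := fps_trunc n.+1 p; set Q := fps_trunc n.+1 q.
set S := fps_trunc n.+1 r.
transitivity ((P * (Q * S))`_n); [|rewrite mulrA]; rewrite coefM /=;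
  apply: eq_bigr => i _; have lein : (i <= n)%N by rewrite -ltnS.
- rewrite -(fps_mul_trunc (N := n.+1)) ?ltnS ?leq_subr //.
  by rewrite coef_poly ltn_ord.
- rewrite -(fps_mul_trunc (N := n.+1)) // coef_poly.
  by rewrite ltnS leq_subr.
Qed.

Fact fps_mul1 : left_id (fpsC 1) fps_mul.
Proof.
move=> p; apply: fpsP => n /=; rewrite big_ord_recl subn0 mul1r big1 ?addr0 //.
by move=> i _; rewrite /= mul0r.
Qed.

Fact fps_mulD : left_distributive fps_mul fps_add.
Proof.
move=> p q r; apply: fpsP => n /=; rewrite -big_split /=.
by apply: eq_bigr => i _; rewrite mulrDl.
Qed.

Fact fps_1neq0 : fpsC 1 != 0.
Proof.
by apply/eqP => /(congr1 (fun p : fps A => p 0%N)) /eqP; rewrite oner_eq0.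
Qed.

HB.instance Definition _ := GRing.Zmodule_isComNzRing.Build (fps A)
  fps_mulA fps_mulC fps_mul1 fps_mulD fps_1neq0.

Fact fpsC_zmod : zmod_morphism fpsC.
Proof. by move=> a b; apply: fpsP => -[|n] /=; rewrite ?subr0. Qed.
Fact fpsC_monoid : monoid_morphism fpsC.
Proof.
split=> // a b; apply: fpsP => n /=; rewrite big_ord_recl subn0 big1.
  by case: n => [|n]; rewrite addr0 ?mulr0.
by move=> i _; rewrite /= mul0r.
Qed.

HB.instance Definition _ := GRing.isZmodMorphism.Build A (fps A) fpsC fpsC_zmod.
HB.instance Definition _ :=
  GRing.isMonoidMorphism.Build A (fps A) fpsC fpsC_monoid.

End FpsRing.

(* k[[x,y]] is k[[x]][[y]], and k[[x,y,u,v]] is k[[x,y]][[u]][[v]].           *)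

Definition kxy (k : fieldType) : comNzRingType := fps (fps k).
Definition kx (k : fieldType) : kxy k := fpsC (fpsX k).
Definition ky (k : fieldType) : kxy k := fpsX (fps k).

Definition kxyuv (k : fieldType) : comNzRingType := fps (fps (kxy k)).
Definition ku (k : fieldType) : kxyuv k := fpsC (fpsX (kxy k)).
Definition kv (k : fieldType) : kxyuv k := fpsX (fps (kxy k)).

Section Ideals.
Variable A : comPzRingType.

Definition ideal (gs : seq A) : {pred A} :=
  fun a => `[< exists c : nat -> A, a = \sum_(i < size gs) c i * gs`_i >].

Lemma idealP (gs : seq A) (a : A) :
  reflect (exists c : nat -> A, a = \sum_(i < size gs) c i * gs`_i)
          (a \in ideal gs).
Proof. exact: asboolP. Qed.

Fact ideal_submod_closed (gs : seq A) : @submod_closed A A^o (ideal gs).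
Proof.
split=> [|a b c /idealP[d ->] /idealP[e ->]]; apply/idealP.
  by exists (fun=> 0); rewrite big1 // => i _; rewrite mul0r.
exists (fun i => a * d i + e i); rewrite scaler_sumr -big_split /=.
by apply: eq_bigr => i _; rewrite mulrDl -mulrA.
Qed.

Fact ideal_zmod_closed (gs : seq A) : zmod_closed (ideal gs).
Proof.
case: (ideal_submod_closed gs) => h0 hL; split=> // a b aI bI.
by have := hL (-1) b a bI aI; rewrite scaleN1r addrC.
Qed.

HB.instance Definition _ (gs : seq A) :=
  GRing.isZmodClosed.Build A (ideal gs) (ideal_zmod_closed gs).

Lemma idealMl (gs : seq A) (a b : A) : b \in ideal gs -> a * b \in ideal gs.
Proof.
case: (ideal_submod_closed gs) => h0 hL bI.
by have := hL a b 0 bI h0; rewrite addr0.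
Qed.

Lemma ideal_pair_sub (I : seq A) (g h : A) :
  g \in ideal I -> h \in ideal I -> {subset ideal [:: g; h] <= ideal I}.
Proof.
move=> gI hI a /idealP[c ->]; rewrite big_ord_recl big_ord1 /=.
by apply: rpredD; apply: idealMl.
Qed.

(* The ideal (gs) as a submodule of A, and as an A-module. *)
Definition ideal_sub (gs : seq A) : {pred A^o} := ideal gs.

HB.instance Definition _ (gs : seq A) :=
  GRing.isSubmodClosed.Build A A^o (ideal_sub gs) (ideal_submod_closed gs).

Definition ideal_module (gs : seq A) := {a : A^o | ideal_sub gs a}.

HB.instance Definition _ (gs : seq A) := SubChoice.on (ideal_module gs).
HB.instance Definition _ (gs : seq A) :=
  [SubChoice_isSubLmodule of ideal_module gs by <:].

Definition divides (a b : A) : Prop := exists c, b = c * a.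

Definition prime_element (p : A) : Prop :=
  [/\ p <> 0, ~ divides p 1
    & forall a b, divides p (a * b) -> divides p a \/ divides p b].

End Ideals.

(* The quotient ring A / (gs).  The quotient construction for rings of        *)
(* ring_quotient needs a proof that the ideal is proper; doing without it     *)
(* only costs the nontriviality of the quotient.                              *)

Section Quotient.
Variables (A : comPzRingType) (gs : seq A).

Definition quo := Quotient.quot (ideal gs).
HB.instance Definition _ := GRing.Zmodule.on quo.
HB.instance Definition _ := EqQuotient.on quo.

Definition quo_pi (a : A) : quo := \pi_(Quotient.quot (ideal gs)) a.

Lemma quo_piE (a b : A) : (quo_pi a == quo_pi b) = (a - b \in ideal gs).
Proof. by rewrite Quotient.idealrBE. Qed.

Lemma quo_piK (z : quo) : quo_pi (repr z) = z.
Proof. exact: reprK. Qed.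

Fact quo_pi_zmod : zmod_morphism quo_pi.
Proof. by move=> a b; rewrite /quo_pi raddfB. Qed.
HB.instance Definition _ := GRing.isZmodMorphism.Build A quo quo_pi quo_pi_zmod.

Definition quo_mul (z w : quo) : quo := quo_pi (repr z * repr w).

Lemma quo_piM (a b : A) : quo_pi (a * b) = quo_mul (quo_pi a) (quo_pi b).
Proof.
have hrep c : c - repr (quo_pi c) \in ideal gs by rewrite -quo_piE quo_piK.
apply/eqP; rewrite quo_piE.
set a' := repr _; set b' := repr _.
rewrite (_ : a * b - a' * b' = b * (a - a') + a' * (b - b')).
  by rewrite rpredD ?idealMl ?hrep.
by rewrite !mulrBr (mulrC b a) (mulrC b a') addrA subrK.
Qed.

Fact quo_mulA : associative quo_mul.
Proof.
move=> x y z; rewrite -[x]quo_piK -[y]quo_piK -[z]quo_piK.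
by rewrite -!quo_piM mulrA.
Qed.
Fact quo_mulC : commutative quo_mul.
Proof. by move=> x y; rewrite /quo_mul mulrC. Qed.
Fact quo_mul1 : left_id (quo_pi 1) quo_mul.
Proof. by move=> x; rewrite -[x]quo_piK -quo_piM mul1r. Qed.
Fact quo_mulD : left_distributive quo_mul +%R.
Proof.
move=> x y z; rewrite -[x]quo_piK -[y]quo_piK -[z]quo_piK.
by rewrite -raddfD -!quo_piM -raddfD mulrDl.
Qed.

HB.instance Definition _ := GRing.Zmodule_isComPzRing.Build quo
  quo_mulA quo_mulC quo_mul1 quo_mulD.

Fact quo_pi_monoid : monoid_morphism quo_pi.
Proof. by split=> // a b; rewrite quo_piM. Qed.
HB.instance Definition _ :=
  GRing.isMonoidMorphism.Build A quo quo_pi quo_pi_monoid.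

End Quotient.

Section AddCategory.
Variable A : comPzRingType.
Implicit Types M N L T : lmodType A.

Definition iso_module M N : Prop := exists phi : {linear M -> N}, bijective phi.

Definition zero_module M : Prop := forall a : M, a = 0.

Definition summand N M : Prop :=
  exists L : lmodType A, iso_module M (N * L)%type.

Definition indecomposable M : Prop :=
  ~ zero_module M /\
  forall N L, iso_module M (N * L)%type -> zero_module N \/ zero_module L.

Definition in_add T M : Prop := exists r : nat, summand M {ffun 'I_r -> T}.

Definition rad M N (phi : {linear M -> N}) : Prop :=
  forall psi : {linear N -> M}, bijective (fun a : M => a - psi (phi a)).

(* rad^2(M, N), computed in add T: finite sums of composites M -> C -> N of   *)
(* two radical maps, through objects C of add T.                              *)
Definition rad2 T M N (phi : M -> N) : Prop :=
  exists (r : nat) (C : 'I_r -> lmodType A)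
         (al : forall i, {linear M -> C i}) (be : forall i, {linear C i -> N}),
    (forall i, [/\ in_add T (C i), rad (al i) & rad (be i)]) /\
    (forall a, phi a = \sum_i be i (al i a)).

Section Quiver.
Variables (k : fieldType) (sc : {rmorphism k -> A}) (T : lmodType A).

(* The phi i lie in rad(M, N), and every class of rad(M, N) / rad^2(M, N) is  *)
(* a unique k-linear combination of the classes of the phi i.                 *)
Definition rad_basis M N (r : nat) (phi : 'I_r -> {linear M -> N}) : Prop :=
  (forall i, rad (phi i)) /\
  (forall psi : {linear M -> N}, rad psi ->
     exists! c : {ffun 'I_r -> k},
       rad2 T (fun a => psi a - \sum_i sc (c i) *: phi i a)).

(* V lists the indecomposable summands of T up to isomorphism, and the        *)
(* arr a b are the arrows V a -> V b.                                         *)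
Record is_quiver (I : finType) (V : I -> lmodType A) (nb : I -> I -> nat)
    (arr : forall a b, 'I_(nb a b) -> {linear V a -> V b}) : Prop := {
  vertex_indecomposable : forall a, indecomposable (V a);
  vertex_summand : forall a, summand (V a) T;
  vertex_exhaustive : forall M, indecomposable M -> summand M T ->
    exists a, iso_module M (V a);
  vertex_distinct : forall a b, iso_module (V a) (V b) -> a = b;
  arrows_basis : forall a b, rad_basis (arr a b)
}.

End Quiver.
End AddCategory.

Section Flag.
Variables (k : fieldType) (n : nat) (f : 'I_n -> kxy k).

Definition fprod (I : {set 'I_n}) : kxy k := \prod_(i in I) f i.

(* R = k[[x,y,u,v]] / (f - uv), with f = f_1 ... f_n. *)
Definition Rring : comPzRingType :=
  quo [:: (fpsC (fpsC (\prod_i f i)) : kxyuv k) - ku k * kv k].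

Definition toR : kxy k -> Rring := @quo_pi (kxyuv k) _ \o @fpsC _ \o @fpsC _.
HB.instance Definition _ := GRing.RMorphism.on toR.

Definition uR : Rring := quo_pi _ (ku k).

Definition kR : k -> Rring := toR \o @fpsC _ \o @fpsC _.
HB.instance Definition _ := GRing.RMorphism.on kR.

Definition Tmod (I : {set 'I_n}) : lmodType Rring :=
  ideal_module [:: uR; toR (fprod I)].

(* F = [:: I_1; ...; I_m] *)
Definition is_flag (F : seq {set 'I_n}) : bool :=
  path (fun I J : {set 'I_n} => I \proper J) set0 (rcons F setT).

Variable F : seq {set 'I_n}.
Let m := size F.

(* T^F = T_{I_1} (+) ... (+) T_{I_m} (+) R *)
Definition TF : lmodType Rring :=
  foldr (fun M N : lmodType Rring => (M * N)%type : lmodType Rring)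
        (Rring^o : lmodType Rring) (map Tmod F).

(* I_0 = set0, I_1, ..., I_m, I_{m+1} = setT *)
Definition flag_set (j : nat) : {set 'I_n} := nth setT (set0 :: F) j.

(* g_j = f_{I_j} / f_{I_{j-1}} for 1 <= j <= m+1, see flag_quotE *)
Definition flag_quot (j : nat) : kxy k :=
  fprod (flag_set j :\: flag_set j.-1).

Lemma flag_quotE (j : nat) : is_flag F -> (j <= m)%N ->
  flag_quot j.+1 * fprod (flag_set j) = fprod (flag_set j.+1).
Proof.
move=> /(pathP setT) hF lejm.
have nthE (s : seq {set 'I_n}) i : nth setT (rcons s setT) i = nth setT s i.
  by rewrite nth_rcons; case: ltngtP => // [lt|->]; rewrite nth_default // ltnW.
have /proper_sub sI : flag_set j \proper flag_set j.+1.
  have := hF j; rewrite size_rcons ltnS -rcons_cons => /(_ lejm).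
  by rewrite !nthE.
rewrite mulrC /flag_quot /fprod [RHS](big_setID (flag_set j)) /=.
by rewrite (setIidPr sI).
Qed.

(* The vertices 0, 1, ..., m stand for R, T_{I_1}, ..., T_{I_m}. *)
Definition vertex (a : nat) : lmodType Rring :=
  if a is j.+1 then Tmod (flag_set j.+1) else Rring^o.

Definition vertex_val (a : nat) : vertex a -> Rring :=
  match a return vertex a -> Rring with
  | 0%N => fun z => z
  | j.+1 => fun z => sval z
  end.

(* phi is the multiplication by the fraction l.1 / l.2; asking l.2 to be a    *)
(* nonzerodivisor makes it an element of the total ring of fractions of R,    *)
(* that is of its fraction field, R being a domain.                           *)
Definition multiplies_by (a b : nat) (phi : vertex a -> vertex b)
    (l : Rring * Rring) : Prop :=
  GRing.lreg l.2 /\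
  forall z, l.2 * vertex_val (phi z) = l.1 * vertex_val z.

(* The labels of the arrows a -> b other than loops.  The inclusions have     *)
(* label 1.  For m = 1, two of the conditions hold simultaneously for         *)
(* (a, b) = (0, 1), and likewise for (a, b) = (1, 0).                         *)
Definition cycle_labels (a b : nat) : seq (Rring * Rring) :=
     (if b == a.+1 then [:: (toR (flag_quot b), 1)] else [::])
  ++ (if (a == 0%N) && (b == m) then [:: (uR, 1)] else [::])
  ++ (if (a == m) && (b == 0%N) then [:: (toR (flag_quot m.+1), uR)] else [::])
  ++ (if a == b.+1 then [:: (1, 1)] else [::]).

Inductive loop_rule (g h : kxy k) : seq (kxy k) -> Prop :=
| no_loop :
    ideal [:: g; h] =i ideal [:: kx k; ky k] -> loop_rule g h [::]
| one_loop t :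
    {subset ideal [:: g; h] <= ideal [:: kx k; ky k]} ->
    ~ (ideal [:: g; h] =i ideal [:: kx k; ky k]) ->
    t \in ideal [:: kx k; ky k] ->
    ideal [:: g; h; t] =i ideal [:: kx k; ky k] -> loop_rule g h [:: t]
| two_loops :
    ~ (exists2 t, t \in ideal [:: kx k; ky k]
                & ideal [:: g; h; t] =i ideal [:: kx k; ky k]) ->
    loop_rule g h [:: kx k; ky k].

Lemma loop_rule_total (g h : kxy k) :
  g \in ideal [:: kx k; ky k] -> h \in ideal [:: kx k; ky k] ->
  exists ts, loop_rule g h ts.
Proof.
move=> gm hm; have [eqI|neqI] := EM (ideal [:: g; h] =i ideal [:: kx k; ky k]).
  by exists [::]; apply: no_loop.
have [[t tm eqt]|not] := EM (exists2 t, t \in ideal [:: kx k; ky k]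
                & ideal [:: g; h; t] =i ideal [:: kx k; ky k]).
  by exists [:: t]; apply: (one_loop (ideal_pair_sub gm hm)).
by exists [:: kx k; ky k]; apply: two_loops.
Qed.

Definition loops_at (a : nat) (ts : seq (kxy k)) : Prop :=
  if a is 0%N then loop_rule (flag_quot 1) (flag_quot m.+1) ts
  else loop_rule (flag_quot a) (flag_quot a.+1) ts.

Definition labels (loops : 'I_m.+1 -> seq (kxy k)) (a b : 'I_m.+1) :
    seq (Rring * Rring) :=
  cycle_labels a b ++
  (if a == b then [seq (toR t, 1) | t <- loops a] else [::]).

End Flag.

(* Main.v *)
From HB Require Import structures.
From mathcomp Require Import all_boot all_order all_algebra.
From mathcomp Require Import boolp zify ring.
Require Import Defs.

Set Implicit Arguments.
Unset Strict Implicit.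
Unset Printing Implicit Defensive.

Import GRing.Theory.
Local Open Scope ring_scope.

(** Put A = k[[x,y]] with maximal ideal (x,y), and place the m+1 modules
    V_0 = R, V_1 = T_{I_1}, ..., V_m = T_{I_m} on a circle, with g_j between
    V_{j-1} and V_j and g_{m+1} between V_m and V_0.  Since uR is isomorphic
    to R, running once around the circle replaces a module by u times itself.
    For vertices a, b let G a b be the product of the g_j met when going
    upwards from a to b, and let wrap a b be 1 if this passes from V_m to V_0
    and 0 otherwise.

    Every homomorphism V_a -> V_b is the multiplication by
    (G a b * al + u * be) / u ^ wrap a b with al, be in R ([hom_coords]):
    al is the part going up, be the part going down.  The reason is that R is,
    up to completion, graded by the powers of u and v = f / u, and that each
    T_I is a free A-module of rank one in each degree; only the degrees 0 and
    1 in u have to be inspected ([hom_normal_form]).  For a <> b the residues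
    of al and be in k are determined by the map ([independence]), because all
    the g_j lie in (x,y).

    Composition of such pairs only involves the identity
    G a b * G b c = G a c, or f * G a c = u * v * G a c if the upward paths
    together make a complete turn ([comp_coords], [comp_coords_wrap],
    [comp_scalar]).  It follows that the V_a have local endomorphism rings and
    are pairwise non-isomorphic, that all maps between distinct vertices are
    radical, and that for a <> b a map lies in the square of the radical
    exactly when al has residue 0 in case b is the upper neighbour of a, and
    be has residue 0 in case b is the lower neighbour ([rad2_offE]).  This
    yields the arrows of the circle.  At a vertex, rad / rad^2 is
    (x,y) / ((x,y)^2 + (g,h)), where g, h are the two adjacent factors
    ([rad2_loop], [loop_sq_descends]), and the rule for the loops describes a
    basis of this space by Nakayama's lemma ([loop_rule_basis]).

    That no other indecomposable summand occurs is the exchange argument of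
    the Krull-Schmidt theorem ([exchange]). *)

(** * Power series and finitely generated ideals *)

Section Fps.
Variable A : comNzRingType.
Implicit Types p q : fps A.

Lemma fpsCM (a : A) p n : (fpsC a * p) n = a * p n.
Proof.
rewrite [LHS]big_ord_recl subn0 big1 ?addr0 // => i _.
by rewrite /= mul0r.
Qed.

Lemma fpsXM p n : (fpsX A * p) n = if n is n'.+1 then p n' else 0.
Proof.
rewrite [LHS]big_ord_recl mul0r add0r; case: n => [|n]; first by rewrite big_ord0.
rewrite big_ord_recl big1 ?addr0 => [|i _]; last by rewrite /= mul0r.
by rewrite mul1r /= subn1.
Qed.

(** The inverse is computed coefficient by coefficient; the list L n holds its
    first n coefficients. *)
Lemma fps_unit p (c : A) : p 0%N * c = 1 -> exists q, p * q = 1.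
Proof.
move=> pc.
pose next n (s : seq A) :=
  c * ((n == 0%N)%:R - \sum_(i < n) p i.+1 * nth 0 s (n - i.+1)).
pose L := fix L n := if n is n'.+1 then rcons (L n') (next n' (L n')) else [::].
have sizeL n : size (L n) = n by elim: n => //= n IH; rewrite size_rcons IH.
have nthL n i : (i < n)%N -> nth 0 (L n) i = nth 0 (L i.+1) i.
  elim: n => // n IH; rewrite ltnS leq_eqVlt => /predU1P[->//|lt].
  by rewrite [in LHS]/= nth_rcons sizeL lt IH.
exists (FPS (fun n => nth 0 (L n.+1) n)); apply: fpsP => n.
rewrite [LHS]big_ord_recl subn0.
have -> : fps_coef (FPS (fun n => nth 0 (L n.+1) n)) n = next n (L n).
  by rewrite /= nth_rcons sizeL ltnn eqxx.
rewrite /next mulrA pc mul1r.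
rewrite [X in _ + X](eq_bigr (fun i : 'I_n =>
  p i.+1 * nth 0 (L n) (n - i.+1))).
  by rewrite subrK; case: n.
move=> i _ /=; congr (_ * _).
by rewrite [RHS]nthL //; have := ltn_ord i; lia.
Qed.

(** The product of the lowest nonzero terms survives. *)
Lemma fps_domain : GRing.integral_domain_axiom A ->
  GRing.integral_domain_axiom (fps A).
Proof.
move=> domA p q pq0; apply/norP => -[p0 q0].
have nz (r : fps A) : r != 0 -> exists i, r i != 0.
  move=> r0; apply: contrapT => no; case/eqP: r0; apply: fpsP => i.
  have -> : fps_coef (0 : fps A) i = 0 by case: i.
  by apply/eqP/negPn/negP => ri; apply: no; exists i.
have [/ex_minnP[i pi mini]] := (nz p p0, nz q q0).
case/ex_minnP => j qj minj.
have /eqP := congr1 (fun r : fps A => r (i + j)%N) pq0.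
have -> : fps_coef (0 : fps A) (i + j) = 0 by case: (i + j)%N.
have lti : (i < (i + j).+1)%N by rewrite ltnS leq_addr.
rewrite /= (bigD1 (Ordinal lti)) //= addKn big1 ?addr0.
  by move=> /eqP/domA; rewrite (negPf pi) (negPf qj).
move=> l; rewrite -val_eqE /= => li.
have [ltl|gel] := ltnP l i.
  by rewrite (_ : p l = 0) ?mul0r //; apply/eqP; case: eqP => // /eqP/mini; lia.
rewrite (_ : q _ = 0) ?mulr0 //; apply/eqP; case: eqP => // /eqP/minj.
by have := ltn_ord l; lia.
Qed.

End Fps.

Section Ideals.
Variable A : comPzRingType.

Lemma ideal1P (g a : A) : reflect (exists c, a = c * g) (a \in ideal [:: g]).
Proof.
apply: (iffP (idealP _ _)) => -[c ->].
  by exists (c 0%N); rewrite big_ord1.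
by exists (fun=> c); rewrite big_ord1.
Qed.

Lemma ideal2P (g h a : A) :
  reflect (exists c d, a = c * g + d * h) (a \in ideal [:: g; h]).
Proof.
apply: (iffP (idealP _ _)) => [[c ->]|[c [d ->]]].
  by exists (c 0%N), (c 1%N); rewrite big_ord_recl big_ord1.
by exists (fun i => if i is 0%N then c else d); rewrite big_ord_recl big_ord1.
Qed.

Lemma ideal3P (g h t a : A) :
  reflect (exists c d e, a = c * g + d * h + e * t) (a \in ideal [:: g; h; t]).
Proof.
apply: (iffP (idealP _ _)) => [[c ->]|[c [d [e ->]]]].
  exists (c 0%N), (c 1%N), (c 2%N).
  by rewrite !big_ord_recl big_ord0 addr0 addrA.
exists (fun i => if i is i'.+1 then if i' is 0%N then d else e else c).
by rewrite !big_ord_recl big_ord0 addr0 addrA.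
Qed.

End Ideals.

(** * The local ring k[[x,y]] and the rule for loops *)

Section PlaneSeries.
Variable k : fieldType.
Local Notation A := (kxy k).
Implicit Types p q s g h t : A.

Definition kC (c : k) : A := fpsC (fpsC c).

Lemma kxy_domain : GRing.integral_domain_axiom A.
Proof. by do 2!apply: fps_domain; move=> a b /eqP; rewrite mulf_eq0. Qed.

Lemma kxyI p q s : p != 0 -> p * q = p * s -> q = s.
Proof.
move=> p0 /eqP; rewrite -subr_eq0 -mulrBr => /eqP/kxy_domain.
by rewrite (negPf p0) subr_eq0 => /eqP.
Qed.

Lemma coef00D p q : (p + q) 0%N 0%N = p 0%N 0%N + q 0%N 0%N.
Proof. by []. Qed.
Lemma coef00B p q : (p - q) 0%N 0%N = p 0%N 0%N - q 0%N 0%N.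
Proof. by []. Qed.
Lemma coef00M p q : (p * q) 0%N 0%N = p 0%N 0%N * q 0%N 0%N.
Proof. by rewrite /= big_ord1 /= big_ord1. Qed.

Lemma kxy_unit p : p 0%N 0%N != 0 -> exists q, p * q = 1.
Proof.
move=> p0; have [c pc] := @fps_unit k (p 0%N) _ (divff p0).
exact: fps_unit pc.
Qed.

Lemma kxy_split p : exists q s, p = kC (p 0%N 0%N) + q * kx k + s * ky k.
Proof.
exists (fpsC (FPS (fun i => p 0%N i.+1))), (FPS (fun j => p j.+1)).
apply: fpsP => j; apply: fpsP => i.
rewrite (mulrC _ (kx k)) (mulrC _ (ky k)).
change (p j i = (kC (p 0%N 0%N) j + (kx k * fpsC (FPS (fun i => p 0%N i.+1))) j
   + (ky k * FPS (fun j => p j.+1)) j) i).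
rewrite /kx /ky fpsCM fpsXM.
case: j => [|j].
  change (p 0%N i = (fpsC (p 0%N 0%N) i + (fpsX k * (FPS (fun i => p 0%N i.+1))) i)
     + (0 : fps k) i).
  by rewrite fpsXM; case: i => [|i] /=; rewrite ?addr0 ?add0r.
rewrite mulr0 !add0r; congr (_ _); by apply: fpsP.
Qed.

Lemma max_ideal p : (p \in ideal [:: kx k; ky k]) = (p 0%N 0%N == 0).
Proof.
apply/ideal2P/eqP => [[c [d ->]]|p0].
  by rewrite coef00D !coef00M /= !mulr0 addr0.
have [q [s]] := kxy_split p; rewrite p0 /kC !raddf0 add0r => ->.
by exists q, s.
Qed.

Lemma subset_max gs : all (fun g : A => g 0%N 0%N == 0) gs ->
  {subset ideal gs <= ideal [:: kx k; ky k]}.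
Proof.
move=> /allP hgs a /idealP[c ->]; apply: rpred_sum => i _.
by rewrite idealMl // max_ideal hgs // mem_nth.
Qed.

Definition in_max_sq s :=
  exists p q, [/\ p 0%N 0%N = 0, q 0%N 0%N = 0 & s = p * kx k + q * ky k].

(** Modulo the ideal, (x,y) is mapped to itself by I - P with P a 2 x 2 matrix
    over (x,y); the determinant of I - P is a unit, and Cramer's rule gives x
    and y. *)
Lemma nakayama gs : all (fun g : A => g 0%N 0%N == 0) gs ->
    (exists2 e, in_max_sq e & kx k - e \in ideal gs) ->
    (exists2 e, in_max_sq e & ky k - e \in ideal gs) ->
  ideal gs =i ideal [:: kx k; ky k].
Proof.
move=> gm [_ [p [q [p0 q0 ->]]] xe] [_ [r [s [r0 s0 ->]]] ye] a.
pose D := (1 - p) * (1 - s) - q * r.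
have [E DE] : exists E, D * E = 1.
  apply: kxy_unit; rewrite /D coef00B !coef00M !coef00B p0 q0 r0 s0.
  by rewrite mulr0 !subr0 mulr1 oner_eq0.
have xI : kx k \in ideal gs.
  have -> : kx k = E * ((1 - s) * (kx k - (p * kx k + q * ky k)) +
                        q * (ky k - (r * kx k + s * ky k))).
    by transitivity (D * E * kx k); [rewrite DE mul1r|rewrite /D; ring].
  by apply: idealMl; apply: rpredD; apply: idealMl; [apply: xe|apply: ye].
have yI : ky k \in ideal gs.
  have -> : ky k = E * (r * (kx k - (p * kx k + q * ky k)) +
                        (1 - p) * (ky k - (r * kx k + s * ky k))).
    by transitivity (D * E * ky k); [rewrite DE mul1r|rewrite /D; ring].
  by apply: idealMl; apply: rpredD; apply: idealMl; [apply: xe|apply: ye].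
apply/idP/idP; first exact: subset_max.
exact: ideal_pair_sub.
Qed.

Lemma kCB c d : kC (c - d) = kC c - kC d. Proof. by rewrite /kC !raddfB. Qed.
Lemma kCM c d : kC (c * d) = kC c * kC d. Proof. by rewrite /kC !rmorphM. Qed.

Definition in_sq_plus g h s :=
  exists e, in_max_sq e /\ s - e \in ideal [:: g; h].

Lemma in_max_sqB e e' : in_max_sq e -> in_max_sq e' -> in_max_sq (e - e').
Proof.
move=> [p [q [p0 q0 ->]]] [r [s [r0 s0 ->]]].
exists (p - r), (q - s); split; last by ring.
  by rewrite coef00B p0 r0 subr0.
by rewrite coef00B q0 s0 subr0.
Qed.

Lemma in_max_sqM a e : in_max_sq e -> in_max_sq (a * e).
Proof.
move=> [p [q [p0 q0 ->]]]; exists (a * p), (a * q); split; last by ring.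
  by rewrite coef00M p0 mulr0.
by rewrite coef00M q0 mulr0.
Qed.

Lemma in_sq_plusB g h s s' :
  in_sq_plus g h s -> in_sq_plus g h s' -> in_sq_plus g h (s - s').
Proof.
move=> [e [e2 eI]] [e' [e2' eI']]; exists (e - e'); split.
  exact: in_max_sqB.
have -> : s - s' - (e - e') = (s - e) - (s' - e') by ring.
exact: rpredB.
Qed.

Lemma in_sq_plusM g h a s : in_sq_plus g h s -> in_sq_plus g h (a * s).
Proof.
move=> [e [e2 eI]]; exists (a * e); split; first exact: in_max_sqM.
by rewrite -mulrBr idealMl.
Qed.

Lemma in_sq_plusM2 g h p q : p 0%N 0%N = 0 -> q 0%N 0%N = 0 ->
  in_sq_plus g h (p * q).
Proof.
move=> p0 /eqP; rewrite -max_ideal => /ideal2P[c [d ->]].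
exists (p * (c * kx k + d * ky k)); split; last by rewrite subrr rpred0.
exists (p * c), (p * d); split; last by ring.
  by rewrite coef00M p0 mul0r.
by rewrite coef00M p0 mul0r.
Qed.

Lemma in_sq_plus_ideal g h s : s \in ideal [:: g; h] -> in_sq_plus g h s.
Proof.
move=> sI; exists 0; rewrite subr0; split=> //.
by exists 0, 0; split=> //; ring.
Qed.

Lemma in_sq_plusD g h s s' :
  in_sq_plus g h s -> in_sq_plus g h s' -> in_sq_plus g h (s + s').
Proof.
move=> sI sI'; have -> : s + s' = s - (-1 * s') by rewrite mulN1r opprK.
exact: in_sq_plusB sI (in_sq_plusM _ sI').
Qed.

Lemma in_sq_plus_diff g h s p q :
  in_sq_plus g h (s - p) -> in_sq_plus g h (s - q) -> in_sq_plus g h (q - p).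
Proof.
by move=> sp sq; have := in_sq_plusB sp sq; rewrite opprB addrC subrKA.
Qed.

(** Modulo (x,y)^2 a coefficient of an element of (x,y) only matters through
    its constant term. *)
Lemma in_sq_plus_const g h c t s :
  t 0%N 0%N = 0 -> in_sq_plus g h (s - c * t) ->
  in_sq_plus g h (s - kC (c 0%N 0%N) * t).
Proof.
move=> t0 sI; rewrite (_ : s - _ = (s - c * t) - (kC (c 0%N 0%N) - c) * t).
  apply: in_sq_plusB => //; apply: in_sq_plusM2 => //.
  by rewrite coef00B subrr.
by ring.
Qed.

Lemma kCV c : c != 0 -> kC c^-1 * kC c = 1.
Proof. by move=> c0; rewrite -kCM mulVf // /kC !rmorph1. Qed.

Lemma solve_lin (a' a b p q e : A) : a' * a = 1 ->
  p - a' * e = a' * (a * p + b * q - e) - a' * b * q.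
Proof.
move=> E; have {1}-> : p = a' * a * p by rewrite E mul1r.
by rewrite !mulrBr mulrDr !mulrA addrAC addrK.
Qed.

(** If a nontrivial combination of the loops fell into (x,y)^2 + (g,h), then
    [nakayama] would generate (x,y) by one element less than the rule claims to
    need. *)
Lemma loop_rule_basis g h ts : g 0%N 0%N = 0 -> h 0%N 0%N = 0 ->
  loop_rule g h ts ->
  all (fun t : A => t 0%N 0%N == 0) ts /\
  forall s, s 0%N 0%N = 0 -> exists! c : {ffun 'I_(size ts) -> k},
    in_sq_plus g h (s - \sum_i kC (c i) * ts`_i).
Proof.
move=> g0 h0 rule.
have g0' : all (fun g : A => g 0%N 0%N == 0) [:: g; h] by rewrite /= g0 h0 !eqxx.
(* Uniqueness of the coefficients reduces to linear independence. *)
suff [tm [ex uni]] : all (fun t : A => t 0%N 0%N == 0) ts /\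
    (forall s, s 0%N 0%N = 0 -> exists c : {ffun 'I_(size ts) -> k},
      in_sq_plus g h (s - \sum_i kC (c i) * ts`_i)) /\
    (forall c : {ffun 'I_(size ts) -> k},
      in_sq_plus g h (\sum_i kC (c i) * ts`_i) -> forall i, c i = 0).
  split=> // s s0; have [c cP] := ex s s0; exists c; split=> // d dP.
  have := in_sq_plus_diff dP cP; rewrite -sumrB => h1.
  apply/ffunP => i; apply/eqP; rewrite -subr_eq0; apply/eqP.
  have cd := uni [ffun i => c i - d i]; have := cd _ i; rewrite ffunE; apply.
  rewrite (eq_bigr (fun i => kC (c i) * ts`_i - kC (d i) * ts`_i)) //.
  by move=> j _; rewrite ffunE kCB mulrBl.
case: rule => [eqI|t _ neqI tm eqI|no].
- split=> //; split=> [s s0|c _ []//].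
  exists [ffun=> 0]; rewrite big_ord0 subr0; apply: in_sq_plus_ideal.
  by rewrite eqI max_ideal s0.
- move: tm; rewrite max_ideal => /eqP t0; split; first by rewrite /= t0 eqxx.
  split=> [s /eqP|c].
    rewrite -max_ideal -eqI => /ideal3P[a [b [c ->]]].
    exists [ffun=> c 0%N 0%N]; rewrite big_ord1 ffunE.
    apply: in_sq_plus_const => //; rewrite addrK; apply: in_sq_plus_ideal.
    by apply/ideal2P; exists a, b.
  rewrite big_ord1 /= => cI i; rewrite ord1; apply/eqP/negPn/negP => c0.
  have tI : in_sq_plus g h t.
    have := in_sq_plusM (kC (c 0)^-1) cI.
    by rewrite mulrA -kCM mulVf // /kC !rmorph1 mul1r.
  (* All of (x,y) then lies in (x,y)^2 + (g,h), so (g,h) = (x,y). *)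
  have all_in s : s 0%N 0%N = 0 -> in_sq_plus g h s.
    move=> /eqP; rewrite -max_ideal -eqI => /ideal3P[a [b [d ->]]].
    apply: in_sq_plusD; last exact: in_sq_plusM.
    by apply: in_sq_plus_ideal; apply/ideal2P; exists a, b.
  case: neqI; apply: nakayama => //.
    have [|e [e2 eI]] := all_in (kx k); first by [].
    by exists e.
  have [|e [e2 eI]] := all_in (ky k); first by [].
  by exists e.
split; first by rewrite /= eqxx.
split=> [s /eqP|c].
  rewrite -max_ideal => /ideal2P[a [b sE]].
  exists [ffun i : 'I_2 => if i == 0 then a 0%N 0%N else b 0%N 0%N].
  rewrite big_ord_recl big_ord1 !ffunE /= opprD addrA.
  apply: in_sq_plus_const => //; rewrite addrAC.
  apply: in_sq_plus_const => //; rewrite sE addrK subrr.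
  by apply: in_sq_plus_ideal; rewrite rpred0.
rewrite big_ord_recl big_ord1 /=; pose a : k := c ord0; pose b : k := c (lift ord0 ord0).
rewrite -[c ord0]/a -[c (lift _ _)]/b => -[e [e2 eI]].
suff ab0 : a = 0 /\ b = 0.
  move=> [[|[|//]] lti].
    by case: ab0 => <- _; rewrite /a; apply: (congr1 c); apply: val_inj.
  by case: ab0 => _ <-; rewrite /b; apply: (congr1 c); apply: val_inj.
apply: contrapT => ab0; apply: no.
have sub3 : {subset ideal [:: g; h] <= ideal [:: g; h; ky k]}.
  move=> s /ideal2P[p [q ->]]; apply/ideal3P.
  by exists p, q, 0; rewrite mul0r addr0.
have sub3' : {subset ideal [:: g; h] <= ideal [:: g; h; kx k]}.
  move=> s /ideal2P[p [q ->]]; apply/ideal3P.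
  by exists p, q, 0; rewrite mul0r addr0.
have tI (t : A) : t \in ideal [:: g; h; t].
  by apply/ideal3P; exists 0, 0, 1; ring.
have in0 : in_max_sq 0 by exists 0, 0; split=> //; ring.
(* If a <> 0, then x is a combination of g, h, y modulo (x,y)^2, so y could
   serve as the element t; if a = 0 and b <> 0, then x could. *)
have [a0|a0] := eqVneq a 0; last first.
  exists (ky k); first by rewrite max_ideal.
  apply: nakayama; first by rewrite /= g0 h0 !eqxx.
    exists (kC a^-1 * e); first exact: in_max_sqM.
    rewrite (solve_lin (kC b) _ (ky k) _ (kCV a0)).
    apply: rpredB; first by apply: idealMl; apply: sub3.
    by apply: idealMl; apply: tI.
  by exists 0; [exact: in0|rewrite subr0; apply: tI].
have b0 : b != 0 by apply/eqP => b0; apply: ab0.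
exists (kx k); first by rewrite max_ideal.
apply: nakayama; first by rewrite /= g0 h0 !eqxx.
  by exists 0; [exact: in0|rewrite subr0; apply: tI].
exists (kC b^-1 * e); first exact: in_max_sqM.
rewrite (solve_lin (kC a) _ (kx k) _ (kCV b0)).
apply: rpredB; first by apply: idealMl; apply: sub3'; rewrite [kC b * _ + _]addrC.
by apply: idealMl; apply: tI.
Qed.

End PlaneSeries.

(** * Radicals, retracts and the exchange property *)

Section Modules.
Variable A : comPzRingType.
Implicit Types M N L V W T C : lmodType A.

Definition kernel M N (phi : {linear M -> N}) : {pred M} :=
  fun z => phi z == 0.

Fact kernel_submod_closed M N (phi : {linear M -> N}) :
  submod_closed (kernel phi).
Proof.
split=> [|a x y]; rewrite !unfold_in ?linear0 //.
by move=> /eqP x0 /eqP y0; rewrite linearP x0 y0 scaler0 addr0.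
Qed.

HB.instance Definition _ M N (phi : {linear M -> N}) :=
  GRing.isSubmodClosed.Build A M (kernel phi) (kernel_submod_closed phi).

Definition kernel_module M N (phi : {linear M -> N}) :=
  {z : M | kernel phi z}.

HB.instance Definition _ M N (phi : {linear M -> N}) :=
  SubChoice.on (kernel_module phi).
HB.instance Definition _ M N (phi : {linear M -> N}) :=
  [SubChoice_isSubLmodule of kernel_module phi by <:].

Definition mk_linear M N (h : M -> N) (hl : linear h) : {linear M -> N} :=
  HB.pack h (GRing.isLinear.Build A M N _ h hl).

Fact pair_inl_linear M N : linear (fun z : M => (z, 0 : N)).
Proof.
move=> a x y; congr (_, _).
by apply/esym; rewrite -[LHS]/(a *: (0 : N) + 0) scaler0 addr0.
Qed.
Definition pair_inl M N := mk_linear (@pair_inl_linear M N).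

Fact pair_inr_linear M N : linear (fun z : N => (0 : M, z)).
Proof.
move=> a x y; congr (_, _).
by apply/esym; rewrite -[LHS]/(a *: (0 : M) + 0) scaler0 addr0.
Qed.
Definition pair_inr M N := mk_linear (@pair_inr_linear M N).

(** A split injection.  In contrast to a direct summand it asks for no
    complement, and composes at once. *)
Definition retract N M : Prop :=
  exists (i : {linear N -> M}) (p : {linear M -> N}), forall z, p (i z) = z.

(** The complement is the kernel of the retraction. *)
Lemma retract_iso N M (i : {linear N -> M}) (p : {linear M -> N}) :
  (forall z, p (i z) = z) -> iso_module M (N * kernel_module p)%type.
Proof.
move=> pK.
have kerP z : kernel p (z - i (p z)) by rewrite /kernel linearB pK subrr.
have hl : linear (fun z => (p z, exist (kernel p) _ (kerP z) : kernel_module p)).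
  move=> a x y; congr (_, _); first exact: linearP.
  apply: val_inj.
  change (a *: x + y - i (p (a *: x + y)) =
          a *: (x - i (p x)) + (y - i (p y))).
  by rewrite (linearP p) (linearP i) scalerBr opprD addrACA.
exists (mk_linear hl); exists (fun z => i z.1 + val z.2) => [z|[x [y /= yk]]].
  by rewrite /= addrC subrK.
have py : p y = 0 by apply/eqP.
congr (_, _); first by rewrite linearD pK py addr0.
by apply: val_inj; rewrite /= linearD pK py addr0 addrAC subrr add0r.
Qed.

Lemma retract_summand N M : retract N M -> summand N M.
Proof. by move=> [i [p /retract_iso]]; exists (kernel_module p). Qed.

Lemma linear_inv M N (phi : {linear M -> N}) : bijective phi ->
  exists psi : {linear N -> M}, cancel phi psi /\ cancel psi phi.
Proof.
move=> [g phiK gK].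
have hl : linear g by move=> a x y; rewrite -{1}[x]gK -{1}[y]gK -linearP phiK.
by exists (mk_linear hl).
Qed.

Lemma summand_retract N M : summand N M -> retract N M.
Proof.
move=> [L [phi /linear_inv[psi [phiK psiK]]]].
exists (psi \o pair_inl N L : {linear _ -> _}).
by exists (fst \o phi : {linear _ -> _}) => z /=; rewrite psiK.
Qed.

Lemma retract_trans N M L : retract N M -> retract M L -> retract N L.
Proof.
move=> [i [p pK]] [j [q qK]].
by exists (j \o i : {linear _ -> _}), (p \o q : {linear _ -> _}) => z /=; rewrite qK pK.
Qed.

(** The form of locality of the endomorphism ring that the exchange argument
    needs. *)
Definition local_end M : Prop := forall phi : {linear M -> M},
  bijective phi \/ bijective (fun z => z - phi z).

(** If c inverts 1 - b a, then 1 + a c b inverts 1 - a b. *)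
Lemma swap_bij M N (al : {linear M -> N}) (be : {linear N -> M}) :
  bijective (fun z => z - be (al z)) -> bijective (fun z => z - al (be z)).
Proof.
move=> [g gK Kg]; exists (fun z => z + al (g (be z))) => z.
  rewrite -[in g _](_ : be z - be (al (be z)) = be (z - al (be z))).
    by rewrite gK subrK.
  by rewrite linearB.
have w : be z + be (al (g (be z))) = g (be z) by rewrite -{1}[be z]Kg subrK.
by rewrite (linearD be) w addrK.
Qed.

(** Locality applied to the projection onto one summand. *)
Lemma local_indecomposable M :
  ~ zero_module M -> local_end M -> indecomposable M.
Proof.
move=> M0 loc; split=> // N L [phi /linear_inv[psi [phiK psiK]]].
have [/bij_inj inj|/bij_inj inj] := 
  loc (psi \o pair_inl N L \o fst \o phi : {linear _ -> _}).
  right=> y; have := inj (psi (0, y)) (psi (0, 0)).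
  rewrite /= !psiK => /(_ erefl) /(congr1 phi).
  by rewrite !psiK => -[].
left=> x; have := inj (psi (x, 0)) (psi (0, 0)).
rewrite /= !psiK /= !subrr => /(_ erefl) /(congr1 phi).
by rewrite !psiK => -[].
Qed.

Lemma iso_sym M N : iso_module M N -> iso_module N M.
Proof. by move=> [phi /linear_inv[psi [phiK psiK]]]; exists psi; exists phi. Qed.

Lemma retract_indec N M : ~ zero_module N -> indecomposable M ->
  retract N M -> iso_module M N.
Proof.
move=> N0 [M0 indec] [i [p pK]].
have [//|ker0] := indec _ _ (retract_iso pK).
exists p; exists i => // z; apply/eqP; rewrite -subr_eq0.
have kerP : kernel p (i (p z) - z) by rewrite /kernel linearB pK subrr.
by have /(congr1 val)/= -> := ker0 (exist (kernel p) _ kerP).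
Qed.

(** Let i and p be the inclusion and the retraction of M, with components i1,
    p1 at V and i2, p2 at W, so that p1 i1 + p2 i2 = 1.  Either i1 p1 is
    invertible and V is a summand of M, or 1 - i1 p1 is, whence so is
    1 - p1 i1 = p2 i2, and M is a retract of W. *)
Lemma exchange M V W : ~ zero_module V -> local_end V -> indecomposable M ->
  retract M (V * W)%type -> iso_module M V \/ retract M W.
Proof.
move=> V0 loc indec [i [p pK]].
pose i1 : {linear M -> V} := fst \o i; pose i2 : {linear M -> W} := snd \o i.
pose p1 : {linear V -> M} := p \o pair_inl V W.
pose p2 : {linear W -> M} := p \o pair_inr V W.
have ipE z : z - p1 (i1 z) = p2 (i2 z).
  rewrite /= -{1}[z]pK -linearB; congr (p _).
  by case: (i z) => x y; congr (_, _); rewrite /= ?subrr ?subr0.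
have [/linear_inv[r [rK _]]|bij] := loc (i1 \o p1 : {linear _ -> _}).
  left; apply: retract_indec => //.
  by exists p1, (r \o i1 : {linear _ -> _}) => z; apply: rK.
right; have [] := @linear_inv _ _ (p2 \o i2 : {linear _ -> _}) _.
  apply: (eq_bij (swap_bij bij)) => z; exact: ipE.
by move=> r [rK _]; exists i2, (r \o p2 : {linear _ -> _}) => z; apply: rK.
Qed.

Lemma rad_compl M N L (phi : {linear M -> N}) (psi : {linear N -> L}) :
  rad phi -> rad (psi \o phi : {linear M -> L}).
Proof. by move=> r chi; apply: (r (chi \o psi : {linear N -> M})). Qed.

(** The condition defining the radical is asymmetric; [swap_bij] moves the new
    factor to the other side. *)
Lemma rad_compr M N L (phi : {linear M -> N}) (psi : {linear N -> L}) :
  rad psi -> rad (psi \o phi : {linear M -> L}).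
Proof.
move=> r chi; apply: (@swap_bij _ _ (chi \o psi : {linear N -> M}) phi) => //=.
apply: (@swap_bij _ _ (phi \o chi : {linear L -> N}) psi) => //=.
apply: (@swap_bij _ _ psi (phi \o chi : {linear L -> N})).
exact: (r (phi \o chi : {linear L -> N})).
Qed.


Section Decompose.
Variables (I : Type) (V : I -> lmodType A).

Definition through M := {c : I & ({linear M -> V c} * {linear V c -> M})%type}.

(** The identity of M is a sum of maps factoring through the V c.  Unlike
    membership in the additive closure of the V c, this is visibly stable under
    sums, powers and retracts, and it suffices to reroute a composite. *)
Definition decomposes M : Prop := exists s : seq (through M),
  forall z, z = \sum_(t <- s) (tagged t).2 ((tagged t).1 z).

Lemma decomposes_vertex c : decomposes (V c).
Proof.
exists [:: existT _ c (idfun : {linear _ -> _}, idfun : {linear _ -> _})] => z.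
by rewrite big_seq1.
Qed.


Lemma decomposes_sum M r (N : 'I_r -> lmodType A)
    (p : forall i, {linear M -> N i}) (q : forall i, {linear N i -> M}) :
  (forall i, decomposes (N i)) -> (forall z, z = \sum_i q i (p i z)) ->
  decomposes M.
Proof.
move=> dec zE.
pose s i := sval (cid (dec i)).
pose ext i (t : through (N i)) : through M :=
  existT _ (tag t) ((tagged t).1 \o p i : {linear M -> V (tag t)},
                    q i \o (tagged t).2 : {linear V (tag t) -> M}).
exists (flatten [seq map (@ext i) (s i) | i <- enum 'I_r]) => z.
rewrite {1}[z]zE big_flatten big_map big_enum; apply: eq_bigr => i _.
rewrite big_map {1}(svalP (cid (dec i)) (p i z)) linear_sum.
by apply: eq_bigr.
Qed.

Lemma decomposes_retract N M : retract N M -> decomposes M -> decomposes N.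
Proof.
move=> [i [p pK]] dec.
apply: (@decomposes_sum _ 1 (fun=> M) (fun=> i) (fun=> p)) => // z.
by rewrite big_ord1 pK.
Qed.

Lemma decomposes_pair M N :
  decomposes M -> decomposes N -> decomposes (M * N)%type.
Proof.
move=> decM decN; pose MN : lmodType A := (M * N)%type.
apply: (@decomposes_sum MN 2 (fun i => if i == 0 :> 'I_2 then M else N)
  (fun i => if i == 0 :> 'I_2 as b
     return {linear MN -> (if b then M else N : lmodType A)}
     then (fst : {linear MN -> M}) else (snd : {linear MN -> N}))
  (fun i => if i == 0 :> 'I_2 as b
     return {linear (if b then M else N : lmodType A) -> MN}
     then pair_inl M N else pair_inr M N)) => [i|[x y]].
  by case: ifP.
by rewrite big_ord_recl big_ord1 /=; congr (_, _); rewrite ?addr0 ?add0r.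
Qed.

Lemma decomposes_ffun r M : decomposes M -> decomposes {ffun 'I_r -> M}.
Proof.
move=> dec; pose MM : lmodType A := {ffun 'I_r -> M}.
have pl i : linear (fun z : MM => z i) by move=> a x y; rewrite !ffunE.
have ql i : linear (fun x : M => [ffun j => if j == i then x else 0] : MM).
  move=> a x y; apply/ffunP => j; rewrite !ffunE.
  by case: ifP; rewrite ?scaler0 ?addr0.
apply: (@decomposes_sum MM r (fun=> M) (fun i => mk_linear (pl i))
  (fun i => mk_linear (ql i))) => // z.
apply/ffunP => j; rewrite sum_ffunE (bigD1 j) //= ffunE eqxx big1 ?addr0 //.
by move=> i /negPf ij; rewrite ffunE eq_sym ij.
Qed.

Lemma in_add_decomposes T C : decomposes T -> in_add T C -> decomposes C.
Proof.
move=> dec [r /summand_retract CT].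
exact: decomposes_retract CT (decomposes_ffun r dec).
Qed.

Lemma retract_in_add T M : retract M T -> in_add T M.
Proof.
move=> MT; exists 1%N; apply: retract_summand; apply: (retract_trans MT).
pose TT : lmodType A := {ffun 'I_1 -> T}.
have pl : linear (fun z : TT => z ord0) by move=> a x y; rewrite !ffunE.
have ql : linear (fun x : T => [ffun=> x] : TT).
  by move=> a x y; apply/ffunP => j; rewrite !ffunE.
by exists (mk_linear ql), (mk_linear pl) => z; rewrite /= ffunE.
Qed.

(** The intermediate objects in the definition of rad^2 are arbitrary objects
    of add T; splitting their identities reduces everything to composites
    through a single vertex. *)
Lemma rad2_ind T a b (P : (V a -> V b) -> Prop) :
    decomposes T -> P (fun=> 0) ->
    (forall phi psi, P phi -> P psi -> P (fun z => phi z + psi z)) ->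
    (forall c (al : {linear V a -> V c}) (be : {linear V c -> V b}),
       rad al -> rad be -> P (fun z => be (al z))) ->
  forall phi : V a -> V b, rad2 T phi -> P phi.
Proof.
move=> dec P0 PD Pcomp phi [r [C [al [be [hrad phiE]]]]].
have Psum (J : Type) (s : seq J) (F : J -> V a -> V b) :
    (forall j, P (F j)) -> P (fun z => \sum_(j <- s) F j z).
  move=> PF; elim: s => [|j s IH].
    by rewrite (_ : (fun _ => _) = fun=> 0) //; apply: funext => z; rewrite big_nil.
  rewrite (_ : (fun _ => _) = fun z => F j z + \sum_(i <- s) F i z).
    exact: PD.
  by apply: funext => z; rewrite big_cons.
have -> : phi = fun z => \sum_i be i (al i z) by apply: funext.
apply: (Psum) => i; have [CT alr ber] := hrad i.
have [s sE] := in_add_decomposes dec CT.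
rewrite (_ : (fun _ => _) =
  fun z => \sum_(t <- s) be i ((tagged t).2 ((tagged t).1 (al i z)))).
  apply: (Psum) => t.
  apply: (Pcomp _ ((tagged t).1 \o al i : {linear V a -> V (tag t)})
                  (be i \o (tagged t).2 : {linear V (tag t) -> V b})).
    exact: rad_compl.
  exact: rad_compr.
by apply: funext => z; rewrite [in LHS](sE (al i z)) linear_sum.
Qed.

Lemma rad2_comp T a b c (al : {linear V a -> V c}) (be : {linear V c -> V b}) :
  in_add T (V c) -> rad al -> rad be -> rad2 T (fun z => be (al z)).
Proof.
move=> cT alr ber.
exists 1%N, (fun=> V c), (fun=> al), (fun=> be); split=> // z.
by rewrite big_ord1.
Qed.

Lemma rad2_add T a b (phi psi : V a -> V b) :
  rad2 T phi -> rad2 T psi -> rad2 T (fun z => phi z + psi z).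
Proof.
move=> [r [C [al [be [hr phiE]]]]] [r' [C' [al' [be' [hr' psiE]]]]].
pose D (s : 'I_r + 'I_r') : lmodType A :=
  match s with inl j => C j | inr j => C' j end.
pose alD s : {linear V a -> D s} :=
  match s with inl j => al j | inr j => al' j end.
pose beD s : {linear D s -> V b} :=
  match s with inl j => be j | inr j => be' j end.
exists (r + r')%N, (fun i => D (split i)), (fun i => alD (split i)),
  (fun i => beD (split i)); split=> [i|z].
  by case: (split i).
rewrite big_split_ord phiE psiE; congr (_ + _); apply: eq_bigr => i _.
  have := unsplitK (inl i : 'I_r + 'I_r'); rewrite /= => E.
  by rewrite E.
have := unsplitK (inr i : 'I_r + 'I_r'); rewrite /= => E.
by rewrite E.
Qed.

End Decompose.
End Modules.

(** * The hypersurface ring R *)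

Section Coefs.
Variable k : fieldType.
Implicit Types (a : kxy k) (s t : kxyuv k).

Definition toS a : kxyuv k := fpsC (fpsC a).

Lemma coefSC a s j i : (toS a * s) j i = a * s j i.
Proof. by rewrite /toS fpsCM fpsCM. Qed.

Lemma coefSu s j i : (ku k * s) j i = if i is i'.+1 then s j i' else 0.
Proof. by rewrite /ku fpsCM fpsXM. Qed.

Lemma coefSv s j i : (kv k * s) j i = if j is j'.+1 then s j' i else 0.
Proof. by rewrite /kv fpsXM; case: j => [|j] //; case: i. Qed.

Lemma coefSD s t j i : (s + t) j i = s j i + t j i. Proof. by []. Qed.
Lemma coefSB s t j i : (s - t) j i = s j i - t j i. Proof. by []. Qed.
Lemma coefS0 j i : (0 : kxyuv k) j i = 0. Proof. by case: j => [|j]; case: i. Qed.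

Lemma coef00SM s t : (s * t) 0%N 0%N = s 0%N 0%N * t 0%N 0%N.
Proof. by rewrite /= big_ord1 /= big_ord1. Qed.

Lemma kxyuv_eq s t : (forall j i, s j i = t j i) -> s = t.
Proof. by move=> st; apply: fpsP => j; apply: fpsP => i; apply: st. Qed.

Lemma kxyuv_split s : exists r r', s = toS (s 0%N 0%N) + ku k * r + kv k * r'.
Proof.
exists (FPS (fun j => FPS (fun i => if j is 0%N then s 0%N i.+1 else 0))).
exists (FPS (fun j => FPS (fun i => s j.+1 i))).
apply: kxyuv_eq => j i; rewrite !coefSD coefSu coefSv.
by case: j => [|j]; case: i => [|i] /=; rewrite ?addr0 ?add0r.
Qed.

Lemma kxyuv_unit s : s 0%N 0%N 0%N 0%N != 0 -> exists t, s * t = 1.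
Proof.
move=> s0; have [c sc] := kxy_unit s0; have [d sd] := fps_unit sc.
exact: fps_unit sd.
Qed.

End Coefs.

Lemma subtract_uv (B : comPzRingType) (s a u v r r' r0 r0' p q : B) :
  s + u * r0 + v * r0' = a + u * r + v * r' + p + q ->
  s = a + u * (r - r0) + v * (r' - r0') + p + q.
Proof.
move=> E; transitivity (s + u * r0 + v * r0' - u * r0 - v * r0'); first by ring.
by rewrite E; ring.
Qed.

Lemma sum_rotate (B : comPzRingType) (a b c d e w : B) :
  a + b + c + d + e + w = a + b + e + w + c + d.
Proof. ring. Qed.

(* From here on, products of series are only used through the ring laws and
   the coefficient formulas above. *)
Opaque fps_mul fps_add fps_opp quo_mul.

Section SurfaceRing.
Variables (k : fieldType) (n : nat) (f : 'I_n -> kxy k).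
Local Notation R := (Rring f).
Local Notation ff := (\prod_i f i).
Hypothesis ff_neq0 : ff != 0.
Hypothesis ff_max : ff 0%N 0%N = 0.
Implicit Types (s t : kxyuv k) (z : R) (a : kxy k).

Definition piR s : R := quo_pi _ s.
Definition vR : R := piR (kv k).

Lemma piRD s t : piR (s + t) = piR s + piR t. Proof. exact: rmorphD. Qed.
Lemma piRB s t : piR (s - t) = piR s - piR t. Proof. exact: rmorphB. Qed.
Lemma piRM s t : piR (s * t) = piR s * piR t. Proof. exact: rmorphM. Qed.
Lemma piR0 : piR 0 = 0. Proof. exact: rmorph0. Qed.
Lemma piR1 : piR 1 = 1. Proof. exact: rmorph1. Qed.

Lemma piR_repr z : piR (repr z) = z.
Proof. exact: quo_piK. Qed.

Lemma piR_surj z : exists s, z = piR s.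
Proof. by exists (repr z); rewrite piR_repr. Qed.

Lemma piR_eqE s t :
  (piR s == piR t) = (s - t \in ideal [:: toS ff - ku k * kv k]).
Proof. exact: quo_piE. Qed.

Lemma toRE a : toR f a = piR (toS a). Proof. by []. Qed.
Lemma uRE : uR f = piR (ku k). Proof. by []. Qed.

Opaque piR.
Lemma uvR : uR f * vR = toR f ff.
Proof.
rewrite toRE uRE /vR -piRM; apply/eqP; rewrite eq_sym piR_eqE.
by apply/ideal1P; exists 1; rewrite mul1r.
Qed.

(** The difference is e * (f - u v), read off on the coefficients of v^j u^i.
    *)
Lemma piR_eq s t : piR s = piR t -> exists e : kxyuv k, forall j i,
  s j i - t j i = ff * e j i -
    (if j is j'.+1 then if i is i'.+1 then e j' i' else 0 else 0).
Proof.
move/eqP; rewrite piR_eqE => /ideal1P[e E]; exists e => j i.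
transitivity ((toS ff * e - ku k * (kv k * e)) j i).
  have -> : toS ff * e - ku k * (kv k * e) = s - t by rewrite E /toS; ring.
  by [].
rewrite coefSB coefSC coefSu; congr (_ - _).
by case: i => [|i]; [case: j|rewrite coefSv].
Qed.

Lemma piR_eq_coef00 s t : piR s = piR t ->
  exists e, s 0%N 0%N - t 0%N 0%N = ff * e.
Proof. by move=> /piR_eq[e E]; exists (e 0%N 0%N); rewrite E subr0. Qed.

(** If u s = e (f - uv), then the terms of e free of u vanish because f is
    nonzero, so that u may be cancelled. *)
Lemma uR_reg : GRing.lreg (uR f).
Proof.
move=> x y /eqP; rewrite -subr_eq0 -mulrBr => /eqP uxy.
apply/eqP; rewrite -subr_eq0; apply/eqP.
have [s sE] := piR_surj (x - y); rewrite sE in uxy *.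
have [e E] : exists e : kxyuv k, forall j i, (ku k * s) j i - (0 : kxyuv k) j i = ff * e j i -
    (if j is j'.+1 then if i is i'.+1 then e j' i' else 0 else 0).
  by apply: piR_eq; rewrite piR0 piRM.
have e0 j : e j 0%N = 0.
  have := E j 0%N; rewrite coefSu coefS0 subr0.
  rewrite (_ : (match j with 0%N => 0 | _ => _ end) = 0) ?subr0; last by case: j.
  by move/esym/kxy_domain; rewrite (negPf ff_neq0) => /eqP.
apply/eqP; rewrite -[0](piR0) piR_eqE subr0; apply/ideal1P.
pose e' : kxyuv k := FPS (fun j => FPS (fun i => e j i.+1)).
exists e'.
have -> : e' * (toS ff - ku k * kv k) = toS ff * e' - ku k * (kv k * e').
  ring.
apply: kxyuv_eq => j i; rewrite coefSB coefSC coefSu.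
have := E j i.+1; rewrite coefSu coefS0 subr0 => ->; congr (_ - _).
by case: i => [|i]; case: j => [|j] //; rewrite ?coefSv // e0.
Qed.

(** The residue map R -> k; it is computed on representatives, and well
    defined since f has constant term 0 ([res_pi]). *)
Definition res z : k := (repr z : kxyuv k) 0%N 0%N 0%N 0%N.

Lemma res_pi s : res (piR s) = s 0%N 0%N 0%N 0%N.
Proof.
have [|e E] := @piR_eq_coef00 (repr (piR s)) s; first exact: piR_repr.
apply/eqP; rewrite -subr_eq0; apply/eqP.
have := congr1 (fun p : kxy k => p 0%N 0%N) E.
by rewrite coef00B coef00M ff_max mul0r.
Qed.

Lemma resB z w : res (z - w) = res z - res w.
Proof.
have [[s ->] [t ->]] := (piR_surj z, piR_surj w).
by rewrite -piRB !res_pi.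
Qed.

Lemma resM z w : res (z * w) = res z * res w.
Proof.
have [[s ->] [t ->]] := (piR_surj z, piR_surj w).
by rewrite -piRM !res_pi coef00SM coef00M.
Qed.

Lemma res_toR a : res (toR f a) = a 0%N 0%N.
Proof. by rewrite toRE res_pi. Qed.

Lemma res_u : res (uR f) = 0. Proof. by rewrite uRE res_pi. Qed.
Lemma res_v : res vR = 0. Proof. by rewrite res_pi. Qed.
Lemma res_kR c : res (kR f c) = c. Proof. by rewrite [LHS]res_toR. Qed.
Lemma res1 : res 1 = 1. Proof. by rewrite -(rmorph1 (toR f)) res_toR. Qed.

Lemma R_split z : exists a r r',
  z = toR f a + uR f * r + vR * r' /\ a 0%N 0%N = res z.
Proof.
have [s ->] := piR_surj z; have [r [r' sE]] := kxyuv_split s.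
exists (s 0%N 0%N), (piR r), (piR r'); rewrite res_pi; split=> //.
by rewrite {1}sE !piRD !piRM.
Qed.

Lemma R_unit z : res z != 0 -> exists w, z * w = 1.
Proof.
have [s ->] := piR_surj z; rewrite res_pi => /kxyuv_unit[t st].
by exists (piR t); rewrite -piRM st piR1.
Qed.

(** Comparing the coefficients of 1 gives al_0 in (g'), those of u give
    be_0 in (g, f); both ideals lie in (x,y). *)
Lemma independence (g g' : kxy k) al be : g * g' = ff -> g != 0 ->
  g 0%N 0%N = 0 -> g' 0%N 0%N = 0 ->
  toR f g * al + uR f * be = 0 -> res al = 0 /\ res be = 0.
Proof.
move=> gg g0 gm gm'; have [[s ->] [t ->]] := (piR_surj al, piR_surj be).
rewrite toRE uRE.
rewrite -!piRM -piRD -piR0 !res_pi.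
move=> /piR_eq[e E]; split.
  have := E 0%N 0%N; rewrite coefS0 coefSD coefSC coefSu !subr0 addr0 -gg -mulrA.
  move/(kxyI g0)/(congr1 (fun p : kxy k => p 0%N 0%N)) => ->.
  by rewrite coef00M gm' mul0r.
have /(congr1 (fun p : kxy k => p 0%N 0%N)) := E 0%N 1%N.
rewrite coefS0 coefSD coefSC coefSu !subr0.
by rewrite coef00D !coef00M ff_max gm !mul0r add0r.
Qed.

(** The relation u v = b b' allows to trade the terms of s1 divisible by v for
    terms of s2. *)
Lemma shift_relation (b b' : kxy k) s1 s2 q : b * b' = ff ->
  piR (ku k * s1 + toS b * s2) =
  piR (ku k * (s1 - kv k * q) + toS b * (s2 + toS b' * q)).
Proof.
move=> bE; apply/eqP; rewrite piR_eqE; apply/ideal1P; exists (- q).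
have -> : toS ff = toS b * toS b' by rewrite -bE /toS !rmorphM.
ring.
Qed.

(** Here w is the image of u under a homomorphism (u, fa) -> (u, fb); the
    hypotheses say that w lies in (u, fb), and that the image fa * w / u of fa
    does so too.  In degree 0 this forces fb to divide fa * p, where u * p is
    the part of w in degree 1, and in the negative degrees it forces the
    coefficient of fb to be divisible by fa'. *)
Lemma hom_normal_form (fa fb fa' fb' : kxy k) (w s1 s2 t1 t2 : R) :
    fa * fa' = ff -> fb * fb' = ff ->
    w = uR f * s1 + toR f fb * s2 ->
    toR f fa * w = uR f * (uR f * t1 + toR f fb * t2) ->
  exists (p c : kxy k) (E r1 r2 : R), fa * p = fb * c /\
    w = uR f * (toR f p + uR f * r1 + toR f fb * r2) + toR f (fb * fa') * E.
Proof.
move=> faE fbE.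
have [fa0 fb0] : fa != 0 /\ fb != 0.
  split; apply/eqP => x0; case/eqP: ff_neq0.
    by rewrite -faE x0 mul0r.
  by rewrite -fbE x0 mul0r.
have [[S1 ->] [S2 ->]] := (piR_surj s1, piR_surj s2).
have [[T1 ->] [T2 ->]] := (piR_surj t1, piR_surj t2).
(* Make the part of U1 free of u a constant. *)
have [P1 P1E] : exists P1 : kxyuv k, forall j, P1 j 0%N = S1 j.+1 0%N.
  by exists (FPS (fun j => FPS (fun i => S1 j.+1 0%N))).
have [U1 U1E] : exists U1, U1 = S1 - kv k * P1 by eexists.
have [U2 U2E] : exists U2, U2 = S2 + toS fb' * P1 by eexists.
move=> wE; have {}wE : w = piR (ku k * U1 + toS fb * U2).
  rewrite U1E U2E -(shift_relation _ _ _ fbE) piRD (piRM (ku k)).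
  by rewrite (piRM (toS fb)) wE !toRE uRE.
have U10 j : U1 j.+1 0%N = 0 by rewrite U1E coefSB coefSv P1E subrr.
rewrite !toRE uRE => eqn.
have /piR_eq[e eE] : piR (toS fa * (ku k * U1 + toS fb * U2)) =
                     piR (ku k * (ku k * T1 + toS fb * T2)).
  rewrite (piRM (toS fa)) -wE (piRM (ku k)) piRD (piRM (ku k)).
  by rewrite (piRM (toS fb)).
(* The coefficients of v^j, of u and of v^(j+1) u in the hypothesis. *)
have e0 j : fa * (fb * U2 j 0%N) = ff * e j 0%N.
  have := eE j 0%N; rewrite coefSC coefSD !coefSu coefSC subr0 add0r => ->.
  by case: j => [|j]; rewrite subr0.
have e1 : fa * (U1 0%N 0%N + fb * U2 0%N 1%N) - fb * T2 0%N 0%N = ff * e 0%N 1%N.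
  have := eE 0%N 1%N.
  by rewrite coefSC coefSD !coefSu !coefSD coefSu !coefSC subr0 add0r.
have e2 j : fa * (fb * U2 j.+1 1%N) - fb * T2 j.+1 0%N = ff * e j.+1 1%N - e j 0%N.
  have := eE j.+1 1%N.
  by rewrite coefSC coefSD !coefSu !coefSD coefSu !coefSC U10 !add0r.
pose d j := fb' * e j.+1 1%N - fa * U2 j.+1 1%N + T2 j.+1 0%N.
(* Since U1 has no term v^(j+1), fb divides e_j, hence fa' divides the
   coefficients of U2 free of u. *)
have dE j : e j 0%N = fb * d j.
  rewrite -[LHS](subKr (ff * e j.+1 1%N)) -e2 -fbE /d; ring.
have U2d j : U2 j 0%N = fa' * d j.
  apply: (kxyI fb0); apply: (kxyI fa0); rewrite e0 dE -faE; ring.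
pose E : kxyuv k := FPS (fun j => FPS (fun i => if i is 0%N then d j else 0)).
pose V2 : kxyuv k := FPS (fun j => FPS (fun i => U2 j i.+1)).
have U2split : U2 = toS fa' * E + ku k * V2.
  apply: kxyuv_eq => j i; rewrite coefSD coefSC coefSu.
  by case: i => [|i] /=; rewrite ?U2d ?addr0 ?mulr0 ?add0r.
pose V1 : kxyuv k := FPS (fun j => FPS (fun i => U1 j i.+1)).
have U1split : U1 = toS (U1 0%N 0%N) + ku k * V1.
  apply: kxyuv_eq => j i; rewrite coefSD coefSu.
  case: i => [|i] /=; last by case: j => [|j]; rewrite ?add0r.
  by case: j => [|j]; rewrite ?U10 ?addr0.
exists (U1 0%N 0%N), (T2 0%N 0%N - fa * U2 0%N 1%N + fb' * e 0%N 1%N).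
exists (piR E), (piR V1), (piR V2); split.
  rewrite mulrDr [fb * (fb' * _)]mulrA fbE -e1; ring.
have -> : piR (ku k) * (toR f (U1 0%N 0%N) + piR (ku k) * piR V1 +
     piR (toS fb) * piR V2) + toR f (fb * fa') * piR E =
   piR (ku k * (toS (U1 0%N 0%N) + ku k * V1 + toS fb * V2) +
        toS (fb * fa') * E).
  rewrite piRD (piRM (toS _)) (piRM (ku k)) piRD piRD (piRM (ku k)).
  by rewrite (piRM (toS fb)) !toRE.
rewrite wE {1}U1split U2split; congr (piR _).
have -> : toS (fb * fa') = toS fb * toS fa' by rewrite /toS !rmorphM.
ring.
Qed.

(** Reduction modulo u and v takes R to A / (f), and f is a multiple of g. *)
Lemma loop_sq_descends (g h g' s : kxy k) (r0 r0' : R) : g * g' = ff ->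
  (exists (p q r r' t t' : R), [/\ res p = 0, res q = 0 &
     toR f s + uR f * r0 + vR * r0' = toR f (kx k) * p + toR f (ky k) * q +
       uR f * r + vR * r' + toR f g * t + toR f h * t']) <->
  in_sq_plus g h s.
Proof.
move=> gE; split.
  move=> [p [q [r [r' [t [t' [p0 q0 /(@subtract_uv R) E]]]]]]].
  have [[P PE] [Q QE]] := (piR_surj p, piR_surj q).
  have [[X XE] [Y YE]] := (piR_surj (r - r0), piR_surj (r' - r0')).
  have [[H HE] [H' HE']] := (piR_surj t, piR_surj t').
  have [|e eE] := @piR_eq_coef00 (toS s) (toS (kx k) * P + toS (ky k) * Q +
      ku k * X + kv k * Y + toS g * H + toS h * H').
    rewrite !piRD (piRM (toS _) P) (piRM (toS _) Q) (piRM _ X) (piRM _ Y).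
    rewrite (piRM _ H) (piRM _ H'); move: E.
    by rewrite PE QE XE YE HE HE' !toRE uRE /vR.
  rewrite PE QE !res_pi in p0 q0.
  exists (P 0%N 0%N * kx k + Q 0%N 0%N * ky k); split.
    by exists (P 0%N 0%N), (Q 0%N 0%N).
  apply/ideal2P; exists (H 0%N 0%N + e * g'), (H' 0%N 0%N).
  move: eE; rewrite !coefSD !coefSC coefSu coefSv -gE => eE.
  have -> : s = g * g' * e + (kx k * P 0%N 0%N + ky k * Q 0%N 0%N + 0 + 0 +
      g * H 0%N 0%N + h * H' 0%N 0%N) by rewrite -eE subrK.
  ring.
have toRD a b : toR f (a + b) = toR f a + toR f b by exact: rmorphD.
have toRM a b : toR f (a * b) = toR f a * toR f b by exact: rmorphM.
move=> [_ [[p [q [p0 q0 ->]]] /ideal2P[c [d E]]]].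
exists (toR f p), (toR f q), r0, r0', (toR f c), (toR f d).
split; [by rewrite res_toR|by rewrite res_toR|].
have sE : s = kx k * p + ky k * q + g * c + h * d.
  by rewrite -[s](subrK (p * kx k + q * ky k)) E; ring.
have tsE : toR f s = toR f (kx k) * toR f p + toR f (ky k) * toR f q +
    toR f g * toR f c + toR f h * toR f d.
  rewrite sE (toRD _ (h * d)) (toRD _ (g * c)) (toRD (kx k * p)).
  by rewrite (toRM (kx k)) (toRM (ky k)) (toRM g) (toRM h).
apply: etrans (congr1 (fun z => z + uR f * r0 + vR * r0') tsE) _.
exact: sum_rotate.
Qed.

End SurfaceRing.

(** * The cyclic quiver *)

(** From here on R enters only through the properties proved above, and the
    modules only through an embedding [value] onto the ideals (u, g_1 ... g_a).
    *)
Section CyclicQuiver.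
Variables (k : fieldType) (A R : comPzRingType) (toR : {rmorphism A -> R}).
Variables (u v : R) (res : {rmorphism R -> k}) (sc : {rmorphism k -> R}).
Variables (m : nat) (g : nat -> A) (x y : A).
Hypothesis m_gt0 : (0 < m)%N.
Hypothesis u_reg : GRing.lreg u.
Hypothesis res_u : res u = 0.
Hypothesis res_v : res v = 0.
Hypothesis res_unit : forall z, res z != 0 -> exists w, z * w = 1.
Hypothesis res_sc : forall c, res (sc c) = c.
Hypothesis res_x : res (toR x) = 0.
Hypothesis res_y : res (toR y) = 0.
Hypothesis max_split : forall z, res z = 0 ->
  exists p q r r', z = toR x * p + toR y * q + u * r + v * r'.
Hypothesis g_reg : forall j, GRing.lreg (g j).
Hypothesis g_max : forall j, (0 < j <= m.+1)%N -> res (toR (g j)) = 0.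

Definition seg i j : A := \prod_(i.+1 <= l < j.+1) g l.
Local Notation ff := (seg 0 m.+1).

Hypothesis uv : u * v = toR ff.
Hypothesis independence : forall (h h' : A) al be, h * h' = ff ->
  res (toR h) = 0 -> res (toR h') = 0 ->
  toR h * al + u * be = 0 -> res al = 0 /\ res be = 0.
Hypothesis normal_form : forall (fa fb fa' fb' : A) w s1 s2 t1 t2,
    fa * fa' = ff -> fb * fb' = ff -> w = u * s1 + toR fb * s2 ->
    toR fa * w = u * (u * t1 + toR fb * t2) ->
  exists p c E r1 r2, fa * p = fb * c /\
    w = u * (toR p + u * r1 + toR fb * r2) + toR (fb * fa') * E.

Local Notation I := 'I_m.+1.
Implicit Types a b c : I.
Variables (V : I -> lmodType R) (value : forall a, V a -> R).
Arguments value {a}.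
Hypothesis value_linear : forall a r (z w : V a),
  value (r *: z + w) = r * value z + value w.
Hypothesis value_inj : forall a, injective (@value a).
Hypothesis value_image : forall a r,
  (exists z : V a, value z = r) <-> exists p q, r = u * p + toR (seg 0 a) * q.

Lemma valueD a (z w : V a) : value (z + w) = value z + value w.
Proof. by rewrite -[z in LHS]scale1r value_linear mul1r. Qed.
Lemma value0 a : value (0 : V a) = 0.
Proof. by apply: (addIr (value (0 : V a))); rewrite add0r -valueD addr0. Qed.
Lemma valueZ a r (z : V a) : value (r *: z) = r * value z.
Proof. by rewrite -[r *: z]addr0 value_linear value0 addr0. Qed.
Lemma valueB a (z w : V a) : value (z - w) = value z - value w.
Proof. by apply: (addIr (value w)); rewrite -valueD !subrK. Qed.

Lemma seg_cat i j l : (i <= j)%N -> (j <= l)%N -> seg i j * seg j l = seg i l.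
Proof. by move=> ij jl; rewrite /seg -big_cat_nat. Qed.

Lemma seg_nil i : seg i i = 1.
Proof. by rewrite /seg big_geq. Qed.

Lemma seg_one i : seg i i.+1 = g i.+1.
Proof. by rewrite /seg big_nat1. Qed.

Lemma seg_reg i j : GRing.lreg (seg i j).
Proof.
apply: (big_ind (fun p : A => GRing.lreg p)) => [|p q|l _].
- exact: lreg1.
- exact: lregM.
- exact: g_reg.
Qed.

Lemma seg_max i j : (i < j)%N -> (j <= m.+1)%N -> res (toR (seg i j)) = 0.
Proof.
move=> ij jm; rewrite -(@seg_cat i i.+1 j) // seg_one !rmorphM /=.
by rewrite g_max ?mul0r // (leq_trans ij).
Qed.

Definition wrap a b : nat := (b < a)%N.

Definition G a b : A := if (a <= b)%N then seg a b else seg 0 b * seg a m.+1.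

Definition next a b := (b == a.+1 :> nat) || (a == m :> nat) && (b == 0%N :> nat).

Lemma leIm a : (a <= m.+1)%N. Proof. exact/ltnW/ltn_ord. Qed.
Hint Resolve leIm : core.

(** The upward path from a to c passes through b. *)
Lemma G_cat a b c : wrap a b + wrap b c = wrap a c -> G a b * G b c = G a c.
Proof.
rewrite /wrap /G.
case: (leqP a b) => ab; case: (leqP b c) => bc; case: (leqP a c) => ac //= _.
- exact: seg_cat.
- by rewrite mulrCA seg_cat.
- by rewrite mulrAC seg_cat.
Qed.

Lemma G_wrap a b : a != b -> G a b * G b a = ff.
Proof.
rewrite -val_eqE /G /= => ab.
case: (ltngtP a b) ab => // ab _.
  by rewrite mulrCA seg_cat // ?seg_cat // ltnW.
by rewrite mulrAC seg_cat // ?seg_cat // ltnW.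
Qed.

Lemma G_id a : G a a = 1. Proof. by rewrite /G leqnn seg_nil. Qed.

Lemma G_max a b : a != b -> res (toR (G a b)) = 0.
Proof.
rewrite -val_eqE /G /= => ab; case: (ltngtP a b) ab => // ab _.
  exact: seg_max.
by rewrite !rmorphM /= (@seg_max a m.+1) ?mulr0.
Qed.

Definition gnext a := g a.+1.
Definition gprev a := if a == 0%N :> nat then g m.+1 else g a.

Lemma G_gnext a b : a != b -> exists h, G a b = gnext a * h.
Proof.
rewrite -val_eqE /G /= => ab; case: (ltngtP a b) ab => // ab _.
  by exists (seg a.+1 b); rewrite /gnext -seg_one seg_cat.
by exists (seg 0 b * seg a.+1 m.+1); rewrite mulrCA /gnext -seg_one seg_cat.
Qed.

Lemma G_gprev a b : a != b -> exists h, G b a = gprev a * h.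
Proof.
rewrite -val_eqE /G /gprev /= => ab.
have prev : (0 < a)%N -> forall i, (i < a)%N -> seg i a = g a * seg i a.-1.
  move=> a0 i ia; rewrite -{2}(prednK a0) -seg_one mulrC seg_cat // ?prednK //.
  by rewrite -ltnS prednK.
case: (posnP a) => [a0|a0].
  rewrite a0 in ab *; rewrite leqNgt lt0n eq_sym ab /=.
  exists (seg b m); rewrite seg_nil mul1r mulrC -seg_one seg_cat //.
  by rewrite -ltnS.
rewrite leqNgt; case: (ltngtP a b) ab => // ab _ /=.
  by exists (seg 0 a.-1 * seg b m.+1); rewrite mulrA prev.
by exists (seg b a.-1); rewrite prev.
Qed.

Lemma wrap_total a b c :
  wrap a b + wrap b c = wrap a c \/ wrap a b + wrap b c = (wrap a c).+1.
Proof. by rewrite /wrap; lia. Qed.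

(** A vertex strictly between a and c on the upward path prevents c from being
    the upper neighbour of a; likewise downwards in [wrap_not_prev]. *)
Lemma wrap_not_next a b c : a != b -> b != c ->
  wrap a b + wrap b c = wrap a c -> ~ next a c.
Proof.
rewrite -!val_eqE /wrap /next /=.
by move: (ltn_ord a) (ltn_ord b) (ltn_ord c); lia.
Qed.

Lemma wrap_not_prev a b c : a != b -> b != c ->
  wrap a b + wrap b c = (wrap a c).+1 -> ~ next c a.
Proof.
rewrite -!val_eqE /wrap /next /=.
by move: (ltn_ord a) (ltn_ord b) (ltn_ord c); lia.
Qed.

Lemma next_exists a : exists2 b, next a b & a != b /\ G a b = gnext a.
Proof.
have [am|am] := eqVneq (a : nat) m.
  exists ord0; first by rewrite /next am !eqxx orbT.
  split; first by rewrite -val_eqE /= am -lt0n.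
  by rewrite /G am leqNgt m_gt0 /= seg_nil mul1r /gnext am seg_one.
have lt : (a.+1 < m.+1)%N by rewrite ltnS ltn_neqAle am -ltnS ltn_ord.
exists (Ordinal lt); first by rewrite /next eqxx.
split; first by rewrite -val_eqE /= neq_ltn leqnn.
by rewrite /G /= leqnSn seg_one.
Qed.

Lemma prev_exists a : exists2 b, next b a & a != b /\ G b a = gprev a.
Proof.
have [a0|a0] := posnP a.
  exists ord_max; first by rewrite /next a0 !eqxx orbT.
  split; first by rewrite -val_eqE /= a0 neq_ltn m_gt0.
  by rewrite /G /gprev /= a0 leqNgt m_gt0 /= seg_nil mul1r seg_one.
have lt : (a.-1 < m.+1)%N by have := ltn_ord a; lia.
exists (Ordinal lt); first by rewrite /next /= prednK // eqxx.
split; first by rewrite -val_eqE /=; lia.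
rewrite /G /gprev /= leq_pred (gtn_eqF a0).
by rewrite -{2}(prednK a0) seg_one prednK.
Qed.

Lemma between_up a b : a != b -> ~ next a b ->
  exists c, [/\ a != c, c != b & wrap a c + wrap c b = wrap a b]%N.
Proof.
move=> ab nab; have [c ac [nac _]] := next_exists a; exists c; split=> //.
  by apply: contra_notN nab => /eqP <-.
move: nac ac ab nab; rewrite -!val_eqE /wrap /next /=.
by move: (ltn_ord a) (ltn_ord b) (ltn_ord c); lia.
Qed.

Lemma between_down a b : a != b -> ~ next b a ->
  exists c, [/\ a != c, c != b & wrap a c + wrap c b = (wrap a b).+1]%N.
Proof.
move=> ab nab; have [c ac [nac _]] := prev_exists a; exists c; split=> //.
  by apply: contra_notN nab => /eqP <-.
move: nac ac ab nab; rewrite -!val_eqE /wrap /next /=.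
by move: (ltn_ord a) (ltn_ord b) (ltn_ord c); lia.
Qed.

(** Coordinates of a map V_a -> V_b: al belongs to the upward path from a to
    b, be to the downward one. *)
Definition coords a b (h : V a -> V b) (al be : R) : Prop :=
  forall z, u ^+ wrap a b * value (h z) = (toR (G a b) * al + u * be) * value z.

Lemma uX_reg i : GRing.lreg (u ^+ i). Proof. exact: lregX. Qed.

Lemma coords_eq a b (h h' : V a -> V b) al be :
  coords h al be -> coords h' al be -> h =1 h'.
Proof.
by move=> hc hc' z; apply: value_inj; apply: (@uX_reg (wrap a b)); rewrite hc hc'.
Qed.

Lemma coords_congr a b (h : V a -> V b) al be al' be' :
  coords h al be -> al = al' -> be = be' -> coords h al' be'.
Proof. by move=> hc <- <-. Qed.

Lemma value_u a : exists z : V a, value z = u.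
Proof. by apply/value_image; exists 1, 0; rewrite mulr1 mulr0 addr0. Qed.

(** A map is determined by the image of u, since u * phi z = phi u * z, and
    [normal_form] describes this image. *)
Lemma hom_coords a b (phi : {linear V a -> V b}) :
  exists al be, coords phi al be.
Proof.
have [zu zuE] := value_u a.
have [zf zfE] : exists z : V a, value z = toR (seg 0 a).
  by apply/value_image; exists 0, 1; rewrite mulr1 mulr0 add0r.
have phiu z : u * value (phi z) = value (phi zu) * value z.
  rewrite [RHS]mulrC -!valueZ -!linearZ; congr (value (phi _)).
  by apply: value_inj; rewrite !valueZ zuE mulrC.
have [s1 [s2 wE]] : exists p q, value (phi zu) = u * p + toR (seg 0 b) * q.
  by apply/value_image; exists (phi zu).
have [t1 [t2 tE]] : exists p q, value (phi zf) = u * p + toR (seg 0 b) * q.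
  by apply/value_image; exists (phi zf).
have faE : seg 0 a * seg a m.+1 = ff by rewrite seg_cat.
have fbE : seg 0 b * seg b m.+1 = ff by rewrite seg_cat.
have := phiu zf; rewrite zfE tE [RHS]mulrC => /esym eqn.
have [p [c [E [r1 [r2 [pc wE']]]]]] := normal_form faE fbE wE eqn.
(* For a <= b the factor seg 0 b * seg a m.+1 is seg a b * f, and f = u v. *)
rewrite /coords /wrap /G; case: leqP => [ab|ba] /=.
  have pE : p = seg a b * c.
    by apply: (@seg_reg 0 a); rewrite pc mulrA seg_cat.
  exists (toR c + toR (seg 0 a) * r2 + v * E), r1 => z.
  apply: u_reg; rewrite expr0 mul1r phiu wE' pE !mulrA; congr (_ * _).
  have -> : toR (seg 0 b * seg a m.+1) = toR (seg a b) * (u * v).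
    rewrite uv -faE -(@seg_cat 0 a b) //; ring.
  rewrite -(@seg_cat 0 a b) //; ring.
exists E, (toR p + u * r1 + toR (seg 0 b) * r2) => z.
by rewrite expr1 phiu wE' addrC.
Qed.

Lemma hom_exists a b l i :
  (forall z : V a, exists w : V b, u ^+ i * value w = l * value z) ->
  exists phi : {linear V a -> V b}, forall z, u ^+ i * value (phi z) = l * value z.
Proof.
move=> hw; have [h hE] := choice hw.
have hl : linear h.
  move=> r z w; apply: value_inj; apply: (@uX_reg i).
  by rewrite hE !value_linear !mulrDr mulrCA hE mulrCA [in RHS]mulrCA hE; ring.
by exists (mk_linear hl).
Qed.

Lemma hom_of_coords a b al be :
  exists phi : {linear V a -> V b}, coords phi al be.
Proof.
apply: hom_exists => z.
have [p [q zE]] : exists p q, value z = u * p + toR (seg 0 a) * q.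
  by apply/value_image; exists z.
rewrite /wrap /G; case: leqP => [ab|ba] /=.
  have [|w wE] := (proj2 (@value_image b ((toR (seg a b) * al + u * be) * value z))).
    exists (toR (seg a b) * al * p + be * value z), (al * q).
    rewrite zE -(@seg_cat 0 a b) //; ring.
  by exists w; rewrite mul1r.
have ba' := ltnW ba.
have [|w wE] := (proj2 (@value_image b
  (toR (seg 0 b) * (toR (seg a m.+1) * al * p + al * v * q) + be * value z))).
  exists (be * p), (toR (seg a m.+1) * al * p + al * v * q +
                    be * toR (seg b a) * q).
  rewrite zE -(@seg_cat 0 b a) //; ring.
exists w; rewrite wE expr1 zE.
transitivity (toR (seg 0 b) * al * (toR (seg a m.+1) * u * p + (u * v) * q) +
  u * be * (u * p + toR (seg 0 a) * q)); first by ring.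
by rewrite uv -(@seg_cat 0 a m.+1) //; ring.
Qed.

Lemma hom_scalar a (phi : {linear V a -> V a}) :
  exists rho, forall z, phi z = rho *: z.
Proof.
have [al [be c]] := hom_coords phi; exists (al + u * be) => z.
apply: value_inj; rewrite valueZ; have := c z.
by rewrite /wrap ltnn expr0 mul1r G_id rmorph1 mul1r.
Qed.

Lemma comp_coords a b c (h : V a -> V b) (h' : V b -> V c) al be al' be' :
    coords h al be -> coords h' al' be' ->
    wrap a b + wrap b c = wrap a c ->
  coords (fun z => h' (h z)) (al * al')
    (toR (G a b) * al * be' + toR (G b c) * be * al' + u * be * be').
Proof.
move=> hc hc' w z; rewrite -w exprD -mulrA hc' mulrCA hc -(G_cat w); ring.
Qed.

(** The two upward paths together exceed the path from a to c by a complete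
    turn, which contributes f = u v; the denominator absorbs the factor u. *)
Lemma comp_coords_wrap a b c (h : V a -> V b) (h' : V b -> V c) al be al' be' :
    coords h al be -> coords h' al' be' -> a != c ->
    wrap a b + wrap b c = (wrap a c).+1 ->
  coords (fun z => h' (h z))
    (v * al * al' + toR (G c b) * al * be' + toR (G b a) * be * al')
    (be * be').
Proof.
move=> hc hc' ac w z; apply: u_reg.
rewrite mulrA -exprS -w exprD -mulrA hc' mulrCA hc.
have [wab wbc] : wrap a c + wrap c b = wrap a b /\
                 wrap b a + wrap a c = wrap b c.
  by move: ac w; rewrite -val_eqE /wrap /=; lia.
have ab : a != b by apply/eqP => E; move: ac w; rewrite -val_eqE E /wrap /=; lia.
have gab := G_cat wab; have gbc := G_cat wbc; have gff := G_wrap ab.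
transitivity ((toR (G a c) * (v * u) * al * al' + u * (toR (G a b) * al * be' +
   toR (G b c) * be * al' + u * be * be')) * value z).
  by rewrite [v * u]mulrC uv -gff -gbc; ring.
by rewrite -gab -gbc; ring.
Qed.

(** Going from a to b and back makes exactly one turn. *)
Lemma comp_scalar a b (h : V a -> V b) (h' : V b -> V a) al be al' be' :
    a != b -> coords h al be -> coords h' al' be' ->
  forall z, h' (h z) = (v * al * al' + toR (G a b) * al * be' +
                        toR (G b a) * be * al' + u * be * be') *: z.
Proof.
move=> ab hc hc' z; apply: value_inj; rewrite valueZ; apply: u_reg.
have w : wrap a b + wrap b a = 1%N.
  by move: ab; rewrite -val_eqE /wrap /=; lia.
rewrite -[u in LHS]expr1 -w exprD -mulrA hc' mulrCA hc.
transitivity ((u * v * al * al' + u * (toR (G a b) * al * be' +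
   toR (G b a) * be * al' + u * be * be')) * value z); last by ring.
by rewrite uv -(G_wrap ab); ring.
Qed.

Lemma scalar_bij a (h : V a -> V a) rho :
  (forall z, h z = rho *: z) -> res rho != 0 -> bijective h.
Proof.
move=> hE /res_unit[w rw]; exists (fun z => w *: z) => z.
  by rewrite hE scalerA mulrC rw scale1r.
by rewrite hE scalerA rw scale1r.
Qed.

Lemma V_neq0 a : ~ zero_module (V a).
Proof.
move=> V0; have [z zu] := value_u a.
have /eqP := oner_neq0 k; apply; rewrite -(rmorph1 res).
have -> : 1 = 0 :> R.
  by apply: u_reg; rewrite mulr1 mulr0 -zu (V0 z) value0.
exact: rmorph0.
Qed.

Lemma V_local a : local_end (V a).
Proof.
move=> phi; have [rho rhoE] := hom_scalar phi.
have [r0|r0] := eqVneq (res rho) 0; last by left; apply: scalar_bij rhoE r0.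
right; apply: (@scalar_bij _ _ (1 - rho)) => [z|].
  by rewrite scalerBl scale1r rhoE.
by rewrite rmorphB rmorph1 r0 subr0 oner_neq0.
Qed.

Lemma rad_scalar a (phi : {linear V a -> V a}) rho :
  (forall z, phi z = rho *: z) -> rad phi <-> res rho = 0.
Proof.
move=> rhoE; split=> [radphi|r0 psi].
  apply/eqP/negPn/negP => /res_unit[w rw].
  have wl : linear (fun z : V a => w *: z).
    by move=> r z z'; rewrite scalerDr !scalerA mulrC.
  have [h hK _] := radphi (mk_linear wl).
  apply: (@V_neq0 a) => z; rewrite -[z]hK /= rhoE scalerA mulrC rw scale1r.
  rewrite subrr -[RHS]hK /=; congr h.
  by rewrite rhoE scalerA mulrC rw scale1r subrr.
have [sig sigE] := hom_scalar psi.
apply: (@scalar_bij _ _ (1 - sig * rho)) => [z|].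
  by rewrite scalerBl scale1r sigE rhoE scalerA.
by rewrite rmorphB rmorph1 rmorphM r0 mulr0 subr0 oner_neq0.
Qed.

(** Each term of [comp_scalar] has residue 0, so 1 - psi phi is a scalar with
    residue 1. *)
Lemma rad_off a b (phi : {linear V a -> V b}) : a != b -> rad phi.
Proof.
move=> ab psi; have [al [be c]] := hom_coords phi.
have [al' [be' c']] := hom_coords psi.
have hE := comp_scalar ab c c'.
set rho := _ + _ in hE.
apply: (@scalar_bij _ _ (1 - rho)) => [z|].
  by rewrite scalerBl scale1r hE.
have -> : res (1 - rho) = 1; last exact: oner_neq0.
rewrite rmorphB rmorph1 /rho !rmorphD !rmorphM /= res_u res_v G_max //.
by rewrite G_max 1?eq_sym // !mul0r !addr0 subr0.
Qed.

Lemma V_distinct a b : iso_module (V a) (V b) -> a = b.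
Proof.
move=> [phi /linear_inv[psi [phiK _]]]; apply/eqP/negPn/negP => ab.
have [h hK _] := rad_off phi ab psi.
by apply: (@V_neq0 a) => z; rewrite -[z]hK -[RHS]hK !phiK !subrr.
Qed.

Variable T : lmodType R.
Hypothesis T_decomposes : decomposes V T.
Hypothesis V_retract : forall a, retract (V a) T.

Lemma rad2_eq a b (h h' : V a -> V b) : h =1 h' -> rad2 T h -> rad2 T h'.
Proof. by move=> /funext->. Qed.

Lemma rad2_of_comp a b c (al : {linear V a -> V c}) (be : {linear V c -> V b}) :
  rad al -> rad be -> rad2 T (fun z => be (al z)).
Proof. by apply: rad2_comp; apply: retract_in_add. Qed.

(** The coordinate description of rad^2 between distinct vertices, proved in
    [rad2_off_sq] and [off_sq_rad2]. *)
Definition off_sq a b (h : V a -> V b) : Prop := exists al be,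
  [/\ coords h al be, next a b -> res al = 0 & next b a -> res be = 0].

Lemma coords_add a b (h h' : V a -> V b) al be al' be' :
  coords h al be -> coords h' al' be' ->
  coords (fun z => h z + h' z) (al + al') (be + be').
Proof. by move=> hc hc' z; rewrite valueD mulrDr hc hc'; ring. Qed.

Lemma coords_sub a b (h h' : V a -> V b) al be al' be' :
  coords h al be -> coords h' al' be' ->
  coords (fun z => h z - h' z) (al - al') (be - be').
Proof. by move=> hc hc' z; rewrite valueB mulrBr hc hc'; ring. Qed.

Lemma coords_scale a b (h : V a -> V b) al be r :
  coords h al be -> coords (fun z => r *: h z) (r * al) (r * be).
Proof. by move=> hc z; rewrite valueZ mulrCA hc; ring. Qed.

Lemma coords0 a b : coords (fun _ : V a => 0 : V b) 0 0.
Proof. by move=> z; rewrite value0; ring. Qed.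

(** A composite through a or b multiplies both coordinates by a non-unit.  For
    a composite through a third vertex c, either c lies on the upward path and
    b is not the upper neighbour, while the downward coordinate is a non-unit;
    or the same holds with up and down exchanged. *)
Lemma rad2_off_sq a b : a != b -> forall h : V a -> V b, rad2 T h -> off_sq h.
Proof.
move=> ab; apply: (rad2_ind T_decomposes).
- by exists 0, 0; rewrite !rmorph0; split=> //; apply: coords0.
- move=> h h' [al [be [hc ha hb]]] [al' [be' [hc' ha' hb']]].
  exists (al + al'), (be + be'); split; first exact: coords_add.
    by move=> n; rewrite rmorphD /= ha // ha' // addr0.
  by move=> n; rewrite rmorphD /= hb // hb' // addr0.
move=> c phi psi rphi rpsi.
have [al [be hc]] := hom_coords phi; have [al' [be' hc']] := hom_coords psi.
have [ac|ac] := eqVneq a c.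
  subst c; have [rho rhoE] := hom_scalar phi.
  have r0 := proj1 (rad_scalar rhoE) rphi.
  exists (rho * al'), (rho * be'); split=> [z|_|_].
  - by rewrite rhoE linearZ valueZ mulrCA hc'; ring.
  - by rewrite rmorphM /= r0 mul0r.
  - by rewrite rmorphM /= r0 mul0r.
have [cb|cb] := eqVneq c b.
  subst c; have [rho rhoE] := hom_scalar psi.
  have r0 := proj1 (rad_scalar rhoE) rpsi.
  exists (rho * al), (rho * be); split=> [z|_|_].
  - by rewrite rhoE valueZ mulrCA hc; ring.
  - by rewrite rmorphM /= r0 mul0r.
  - by rewrite rmorphM /= r0 mul0r.
have [w|w] := wrap_total a c b.
  do 2!eexists; split; first exact: comp_coords hc hc' w.
    by move/(wrap_not_next ac cb w).
  by rewrite !rmorphD !rmorphM /= res_u !G_max // !mul0r !addr0.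
do 2!eexists; split; first exact: comp_coords_wrap hc hc' ab w.
  by rewrite !rmorphD !rmorphM /= res_v !G_max 1?eq_sym // !mul0r !addr0.
by move/(wrap_not_prev ac cb w).
Qed.

Lemma scale_hom a r : exists phi : {linear V a -> V a}, forall z, phi z = r *: z.
Proof.
have wl : linear (fun z : V a => r *: z).
  by move=> s z z'; rewrite scalerDr !scalerA mulrC.
by exists (mk_linear wl).
Qed.

(** A basic path of length one occurs with a coefficient of residue 0, which is
    a radical endomorphism of V_a; a longer one factors through the neighbour
    of a. *)
Lemma off_sq_rad2 a b : a != b -> forall h : V a -> V b, off_sq h -> rad2 T h.
Proof.
move=> ab h [al [be [hc ha hb]]].
have [up upE] := hom_of_coords a b 1 0; have [dn dnE] := hom_of_coords a b 0 1.
apply: (@rad2_eq _ _ (fun z => al *: up z + be *: dn z)).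
  apply: coords_eq hc.
  apply: coords_congr (coords_add (coords_scale al upE) (coords_scale be dnE)) _ _.
    by ring.
  by ring.
have factor r (phi : {linear V a -> V b}) : res r = 0 ->
    rad2 T (fun z => r *: phi z).
  move=> r0; have [s sE] := scale_hom a r.
  apply: (@rad2_eq _ _ (fun z => phi (s z))) => [z|].
    by rewrite sE linearZ.
  by apply: rad2_of_comp; [apply/(rad_scalar sE)|apply: rad_off].
apply: rad2_add.
  case: (boolP (next a b)) => [/ha/factor//|/negP n].
  have [c [ac cb w]] := between_up ab n.
  have [phi phiE] := hom_of_coords a c al 0.
  have [psi psiE] := hom_of_coords c b 1 0.
  apply: (@rad2_eq _ _ (fun z => psi (phi z))); last first.
    by apply: rad2_of_comp; apply: rad_off.
  apply: coords_eq (comp_coords phiE psiE w) _.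
  by apply: coords_congr (coords_scale al upE) _ _; ring.
case: (boolP (next b a)) => [/hb/factor//|/negP n].
have [c [ac cb w]] := between_down ab n.
have [phi phiE] := hom_of_coords a c 0 be.
have [psi psiE] := hom_of_coords c b 0 1.
apply: (@rad2_eq _ _ (fun z => psi (phi z))); last first.
  by apply: rad2_of_comp; apply: rad_off.
apply: coords_eq (comp_coords_wrap phiE psiE ab w) _.
by apply: coords_congr (coords_scale be dnE) _ _; ring.
Qed.

(** [independence] applied to the difference, with f = G a b * G b a. *)
Lemma coords_res a b (h : V a -> V b) al be al' be' : a != b ->
  coords h al be -> coords h al' be' -> res al = res al' /\ res be = res be'.
Proof.
move=> ab hc hc'.
have [z zu] := value_u a.
have [||||r1 r2] := @independence (G a b) (G b a) (al - al') (be - be').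
- exact: G_wrap.
- exact: G_max.
- by rewrite G_max // eq_sym.
- apply: u_reg; rewrite mulr0.
  have := hc z; rewrite hc' zu => E.
  transitivity ((toR (G a b) * al + u * be) * u -
    (toR (G a b) * al' + u * be') * u); first by ring.
  by rewrite E subrr.
by split; apply/eqP; rewrite -subr_eq0 -rmorphB /= ?r1 ?r2.
Qed.

Lemma rad2_offE a b (h : V a -> V b) al be : a != b -> coords h al be ->
  rad2 T h <-> (next a b -> res al = 0) /\ (next b a -> res be = 0).
Proof.
move=> ab hc; split=> [/(rad2_off_sq ab)[al' [be' [hc' ha hb]]]|[ha hb]].
  by have [-> ->] := coords_res ab hc hc'.
by apply: off_sq_rad2 => //; exists al, be.
Qed.

(** The ideal of the scalars in rad^2(V_a, V_a): with M the kernel of the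
    residue map, it is M^2 + (u, v, gprev a, gnext a). *)
Definition loop_sq a (rho : R) : Prop := exists p q r r' s t,
  [/\ res p = 0, res q = 0 & rho = toR x * p + toR y * q + u * r + v * r' +
     toR (gprev a) * s + toR (gnext a) * t].

Lemma loop_sqD a r s : loop_sq a r -> loop_sq a s -> loop_sq a (r + s).
Proof.
move=> [p [q [r1 [r2 [s1 [s2 [p0 q0 ->]]]]]]].
move=> [p' [q' [r1' [r2' [s1' [s2' [p0' q0' ->]]]]]]].
exists (p + p'), (q + q'), (r1 + r1'), (r2 + r2'), (s1 + s1'), (s2 + s2').
by rewrite !rmorphD /= p0 p0' q0 q0' addr0; split=> //; ring.
Qed.

Lemma loop_sqM a r s : res r = 0 -> res s = 0 -> loop_sq a (r * s).
Proof.
move=> /max_split[p [q [r1 [r2 ->]]]] s0.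
exists (p * s), (q * s), (r1 * s), (r2 * s), 0, 0.
by rewrite !rmorphM /= s0 !mulr0; split=> //; ring.
Qed.

Lemma scalar_inj a r s : (forall z : V a, r *: z = s *: z) -> r = s.
Proof.
move=> rs; have [z zu] := value_u a.
have := congr1 value (rs z); rewrite !valueZ zu ![_ * u]mulrC; exact: u_reg.
Qed.

Lemma rad2_loop_sq a (h : V a -> V a) rho : (forall z, h z = rho *: z) ->
  rad2 T h -> loop_sq a rho.
Proof.
move=> rhoE hrad.
suff [r rE rsq] : exists2 r, forall z, h z = r *: z & loop_sq a r.
  by rewrite (@scalar_inj a rho r) // => z; rewrite -rhoE.
move: h hrad {rho rhoE}; apply: (rad2_ind T_decomposes).
- exists 0 => [z|]; first by rewrite scale0r.
  by exists 0, 0, 0, 0, 0, 0; rewrite !rmorph0; split=> //; ring.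
- move=> h h' [r rE rsq] [s sE ssq]; exists (r + s) => [z|].
    by rewrite rE sE scalerDl.
  exact: loop_sqD.
move=> c phi psi rphi rpsi.
have [ac|ac] := eqVneq a c.
  subst c; have [r rE] := hom_scalar phi; have [s sE] := hom_scalar psi.
  exists (r * s) => [z|]; first by rewrite sE rE scalerA mulrC.
  exact: loop_sqM (proj1 (rad_scalar rE) rphi) (proj1 (rad_scalar sE) rpsi).
have [al [be hc]] := hom_coords phi; have [al' [be' hc']] := hom_coords psi.
eexists; first exact: comp_scalar ac hc hc'.
have [[h1 ->] [h2 ->]] := (G_gnext ac, G_gprev ac).
exists 0, 0, (be * be'), (al * al'), (toR h2 * be * al'), (toR h1 * al * be').
by rewrite rmorph0; split=> //; ring.
Qed.

Lemma rad2_scale_comp a r s : res r = 0 -> res s = 0 ->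
  rad2 T (fun z : V a => (r * s) *: z).
Proof.
move=> r0 s0; have [phi phiE] := scale_hom a r.
have [psi psiE] := scale_hom a s.
apply: (@rad2_eq _ _ (fun z => psi (phi z))) => [z|].
  by rewrite psiE phiE scalerA mulrC.
by apply: rad2_of_comp; [apply/(rad_scalar phiE)|apply/(rad_scalar psiE)].
Qed.

(** The round trips through b supply v, u, G a b and G b a, each with
    arbitrary coefficient. *)
Lemma rad2_cycle a b al be al' be' : a != b ->
  rad2 T (fun z : V a => (v * al * al' + toR (G a b) * al * be' +
                        toR (G b a) * be * al' + u * be * be') *: z).
Proof.
move=> ab; have [phi phiE] := hom_of_coords a b al be.
have [psi psiE] := hom_of_coords b a al' be'.
apply: (@rad2_eq _ _ (fun z => psi (phi z))).
  exact: comp_scalar ab phiE psiE.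
by apply: rad2_of_comp; apply: rad_off; rewrite // eq_sym.
Qed.

Lemma loop_sq_rad2 a rho : loop_sq a rho -> rad2 T (fun z : V a => rho *: z).
Proof.
move=> [p [q [r [r' [s [t [p0 q0 ->]]]]]]].
have [b _ [ab Gab]] := next_exists a; have [c _ [ac Gca]] := prev_exists a.
have split2 r1 r2 : rad2 T (fun z : V a => r1 *: z) ->
    rad2 T (fun z : V a => r2 *: z) -> rad2 T (fun z : V a => (r1 + r2) *: z).
  move=> h1 h2; apply: rad2_eq (rad2_add h1 h2) => z.
  by rewrite scalerDl.
have reduce r1 r2 : r1 = r2 -> rad2 T (fun z : V a => r1 *: z) ->
  rad2 T (fun z : V a => r2 *: z) by move=> ->.
apply: (split2); last first.
  rewrite -Gab; apply: (reduce _ _ _ (rad2_cycle t 0 0 1 ab)); ring.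
apply: (split2); last first.
  rewrite -Gca; apply: (reduce _ _ _ (rad2_cycle 0 s 1 0 ac)); ring.
apply: (split2); last first.
  apply: (reduce _ _ _ (rad2_cycle r' 0 1 0 ab)); ring.
apply: (split2); last first.
  apply: (reduce _ _ _ (rad2_cycle 0 r 0 1 ab)); ring.
by apply: (split2); apply: rad2_scale_comp.
Qed.

Lemma rad2_loop a (h : V a -> V a) rho : (forall z, h z = rho *: z) ->
  rad2 T h <-> loop_sq a rho.
Proof.
move=> rhoE; split; first exact: rad2_loop_sq.
by move/loop_sq_rad2; apply: rad2_eq => z; rewrite rhoE.
Qed.

Lemma coords_sum a b r (h : 'I_r -> V a -> V b) (al be : 'I_r -> R) :
  (forall i, coords (h i) (al i) (be i)) ->
  coords (fun z => \sum_i h i z) (\sum_i al i) (\sum_i be i).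
Proof.
move=> hc z.
have -> : value (\sum_i h i z) = \sum_i value (h i z).
  elim/big_rec2: _ => [|i p q _ <-]; first exact: value0.
  by rewrite valueD.
rewrite !mulr_sumr -big_split /= mulr_suml; apply: eq_bigr => i _.
exact: hc.
Qed.

Definition cycle_arrows a b : seq (R * R) :=
  (if next a b then [:: (toR (G a b), u ^+ wrap a b)] else [::]) ++
  (if next b a then [:: (u ^+ (1 - wrap a b), 1)] else [::]).

(** By [rad2_offE], rad / rad^2 is the direct sum of a copy of k for each of
    the coordinates that belongs to a path of length one. *)
Lemma off_basis a b (s : seq (R * R))
    (phi : 'I_(size s) -> {linear V a -> V b}) :
  a != b -> s = cycle_arrows a b ->
  (forall (i : 'I_(size s)) (z : V a), (nth (0, 0) s i).2 * value (phi i z) =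
               (nth (0, 0) s i).1 * value z) ->
  rad_basis sc T phi.
Proof.
move=> ab sE phiE; split=> [i|psi _]; first exact: rad_off.
have [al [be hc]] := hom_coords psi.
(* In terms of the coordinates e, e' of the arrows, membership in rad^2 is a
   system of linear equations over k. *)
suff [e [e' [phic uni]]] : exists e e' : 'I_(size s) -> R,
    (forall i, coords (phi i) (e i) (e' i)) /\
    (exists! c : {ffun 'I_(size s) -> k},
      (next a b -> res al = \sum_i c i * res (e i)) /\
      (next b a -> res be = \sum_i c i * res (e' i))).
  have equiv (c : {ffun 'I_(size s) -> k}) :
      rad2 T (fun z => psi z - \sum_i sc (c i) *: phi i z) <->
      (next a b -> res al = \sum_i c i * res (e i)) /\
      (next b a -> res be = \sum_i c i * res (e' i)).
    have hc' : coords (fun z => psi z - \sum_i sc (c i) *: phi i z)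
        (al - \sum_i sc (c i) * e i) (be - \sum_i sc (c i) * e' i).
      apply: coords_sub hc _; apply: coords_sum => i.
      exact: coords_scale (phic i).
    have sumE (d : 'I_(size s) -> R) :
        res (\sum_i sc (c i) * d i) = \sum_i c i * res (d i).
      by rewrite rmorph_sum; apply: eq_bigr => i _; rewrite rmorphM /= res_sc.
    have subE w z : res (w - z) = 0 <-> res w = res z.
      rewrite rmorphB; split=> [/eqP|->]; last exact: subrr.
      by rewrite subr_eq0 => /eqP.
    apply: (iff_trans (rad2_offE ab hc')).
    split=> -[h1 h2]; split.
    - by move=> /h1/subE; rewrite sumE.
    - by move=> /h2/subE; rewrite sumE.
    - by move=> n; apply/subE; rewrite sumE h1.
    - by move=> n; apply/subE; rewrite sumE h2.
  case: uni => c [cP uni]; exists c; split; first exact/equiv.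
  by move=> c' /equiv/uni.
subst s; move: phi phiE; rewrite /cycle_arrows.
have coord_up (h : {linear V a -> V b}) :
    (forall z, u ^+ wrap a b * value (h z) = toR (G a b) * value z) -> coords h 1 0.
  by move=> hE z; rewrite hE; ring.
have coord_dn (h : {linear V a -> V b}) :
    (forall z, 1 * value (h z) = u ^+ (1 - wrap a b) * value z) -> coords h 0 1.
  move=> hE z; rewrite -[value (h z)]mul1r hE mulrA -exprD.
  by rewrite subnKC ?leq_b1 //; ring.
case: (next a b); case: (next b a) => /= phi phiE.
- exists (fun i => if i == 0 :> nat then 1 else 0),
    (fun i => if i == 0 :> nat then 0 else 1); split.
    case=> [[|[|//]] lti] /=.
      by apply: coord_up => z; exact: (phiE (Ordinal lti) z).
    by apply: coord_dn => z; exact: (phiE (Ordinal lti) z).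
  exists [ffun i : 'I_2 => if i == 0 :> nat then res al else res be]; split.
    by rewrite !big_ord_recl !big_ord0 !ffunE /= !rmorph1 !rmorph0; split=> _; ring.
  move=> c [/(_ isT) h1 /(_ isT) h2]; apply/ffunP => i; rewrite ffunE.
  move: h1 h2; rewrite !big_ord_recl !big_ord0 /= !rmorph1 !rmorph0.
  rewrite !mulr0 !mulr1 !addr0 !add0r => -> ->.
  case: i => [[|[|//]] lti] /=; congr (c _); exact: val_inj.
- exists (fun=> 1), (fun=> 0); split.
    case=> [[|//] lti] /=.
    by apply: coord_up => z; exact: (phiE (Ordinal lti) z).
  exists [ffun i : 'I_1 => res al]; split.
    by rewrite !big_ord1 ffunE rmorph1 mulr1.
  move=> c [/(_ isT) h1 _]; apply/ffunP => i; rewrite ffunE.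
  by rewrite h1 big_ord1 rmorph1 mulr1 (ord1 i).
- exists (fun=> 0), (fun=> 1); split.
    case=> [[|//] lti] /=.
    by apply: coord_dn => z; exact: (phiE (Ordinal lti) z).
  exists [ffun i : 'I_1 => res be]; split.
    by rewrite !big_ord1 ffunE rmorph1 mulr1.
  move=> c [_ /(_ isT) h1]; apply/ffunP => i; rewrite ffunE.
  by rewrite h1 big_ord1 rmorph1 mulr1 (ord1 i).
exists (fun=> 0), (fun=> 0); split; first by case.
exists [ffun=> 0]; split=> // c _; apply/ffunP => -[] //.
Qed.

Lemma loop_basis a (ts : seq A) r (phi : 'I_r -> {linear V a -> V a}) :
  r = size ts ->
  all (fun t => res (toR t) == 0) ts ->
  (forall (i : 'I_r) (z : V a), value (phi i z) = toR ts`_i * value z) ->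
  (forall rho, res rho = 0 -> exists! c : {ffun 'I_r -> k},
     loop_sq a (rho - \sum_i sc (c i) * toR ts`_i)) ->
  rad_basis sc T phi.
Proof.
move=> rE /allP tm phiE uni.
have phiS i z : phi i z = toR ts`_i *: z.
  by apply: value_inj; rewrite phiE valueZ.
split=> [i|psi rpsi].
  by apply/(rad_scalar (phiS i))/eqP/tm; rewrite mem_nth // -rE.
have [rho rhoE] := hom_scalar psi.
have [c [cP cU]] := uni rho (proj1 (rad_scalar rhoE) rpsi).
have E (d : {ffun 'I_r -> k}) z : psi z - \sum_i sc (d i) *: phi i z =
    (rho - \sum_i sc (d i) * toR ts`_i) *: z.
  rewrite scalerBl scaler_suml rhoE; congr (_ - _); apply: eq_bigr => i _.
  by rewrite phiS scalerA.
exists c; split; first exact/(rad2_loop (E c)).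
by move=> d /(rad2_loop (E d))/cU.
Qed.

Lemma cycle_arrow_exists a b l : a != b -> l \in cycle_arrows a b ->
  GRing.lreg l.2 /\
  exists phi : {linear V a -> V b}, forall z, l.2 * value (phi z) = l.1 * value z.
Proof.
move=> ab; rewrite /cycle_arrows mem_cat => /orP[].
  case: ifP => // _; rewrite inE => /eqP-> /=; split; first exact: uX_reg.
  have [phi phiE] := hom_of_coords a b 1 0; exists phi => z.
  by rewrite phiE; ring.
case: ifP => // _; rewrite inE => /eqP-> /=; split; first exact: lreg1.
have [phi phiE] := hom_of_coords a b 0 1; exists phi => z.
apply: (@uX_reg (wrap a b)); rewrite mul1r phiE mulrA -exprD.
by rewrite subnKC ?leq_b1 //; ring.
Qed.

Hypothesis T_exhaustive :
  (forall a, ~ zero_module (V a)) -> (forall a, local_end (V a)) ->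
  forall M, indecomposable M -> retract M T -> exists a, iso_module M (V a).

Variables (ts : I -> seq A) (lbl : I -> I -> seq (R * R)).
Hypothesis ts_max : forall a, all (fun t => res (toR t) == 0) (ts a).
Hypothesis ts_basis : forall a rho, res rho = 0 ->
  exists! c : {ffun 'I_(size (ts a)) -> k},
     loop_sq a (rho - \sum_i sc (c i) * toR (ts a)`_i).
Hypothesis lbl_off : forall a b, a != b -> lbl a b = cycle_arrows a b.
Hypothesis lbl_loop : forall a, lbl a a = [seq (toR t, 1) | t <- ts a].

Lemma cyclic_quiver :
  exists arr : forall a b, 'I_(size (lbl a b)) -> {linear V a -> V b},
    (forall a b (i : 'I_(size (lbl a b))),
       let l := nth (0, 0) (lbl a b) i in
       GRing.lreg l.2 /\
       forall z : V a, l.2 * value (arr a b i z) = l.1 * value z) /\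
    is_quiver sc T arr.
Proof.
have arrow a b (i : 'I_(size (lbl a b))) : let l := nth (0, 0) (lbl a b) i in
    GRing.lreg l.2 /\ exists phi : {linear V a -> V b},
      forall z, l.2 * value (phi z) = l.1 * value z.
  have [ab|ab] := eqVneq a b; last first.
    apply: cycle_arrow_exists => //; rewrite -lbl_off //; exact: mem_nth.
  subst b.
  have /mapP[t _ lE] : nth (0, 0) (lbl a a) i \in [seq (toR t, 1) | t <- ts a].
    by rewrite -lbl_loop mem_nth.
  rewrite lE; split; first exact: lreg1.
  have [phi phiE] := scale_hom a (toR t); exists phi => z.
  by rewrite phiE valueZ mul1r.
exists (fun a b i => sval (cid (proj2 (arrow a b i)))); split=> [a b i|].
  by split; [case: (arrow a b i)|case: cid].
split=> [a|a|M Mi MT|a b|a b].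
- exact: local_indecomposable (@V_neq0 a) (@V_local a).
- exact: retract_summand.
- exact: T_exhaustive V_neq0 V_local M Mi (summand_retract MT).
- exact: V_distinct.
have [ab|ab] := eqVneq a b; last first.
  by apply: off_basis => // [|i z]; [apply: lbl_off|case: cid].
subst b; have sE : size (lbl a a) = size (ts a) by rewrite lbl_loop size_map.
have nthE j : (j < size (ts a))%N ->
    nth (0, 0) (lbl a a) j = (toR (ts a)`_j, 1).
  by move=> ja; rewrite lbl_loop (nth_map 0).
apply: (loop_basis sE (ts_max a)) => [i z|rho r0].
  case: cid => phi /= phiE; have := phiE z.
  by rewrite nthE /= ?mul1r // -sE.
move: (size (lbl a a)) sE => r ->; exact: ts_basis.
Qed.

End CyclicQuiver.

(** * Iterated products of modules *)

Section IteratedProduct.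
Variables (A : comPzRingType) (X : eqType) (N : X -> lmodType A) (B : lmodType A).

Definition iter_prod (s : seq X) : lmodType A :=
  foldr (fun M N : lmodType A => (M * N)%type : lmodType A) B (map N s).

Lemma retract_pair_l (M L : lmodType A) : retract M (M * L)%type.
Proof. by exists (pair_inl M L), (fst : {linear (M * L)%type -> M}). Qed.

Lemma retract_pair_r (M L : lmodType A) : retract L (M * L)%type.
Proof. by exists (pair_inr M L), (snd : {linear (M * L)%type -> L}). Qed.

Lemma retract_iter_base s : retract B (iter_prod s).
Proof.
elim: s => [|x s IH]; first by exists idfun, idfun.
exact: retract_trans IH (retract_pair_r _ _).
Qed.

Lemma retract_iter s x : x \in s -> retract (N x) (iter_prod s).
Proof.
elim: s => // y s IH; rewrite inE => /orP[/eqP->|/IH h].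
  exact: retract_pair_l.
exact: retract_trans h (retract_pair_r _ _).
Qed.

Lemma decomposes_iter (I : Type) (V : I -> lmodType A) s :
  decomposes V B -> (forall x, x \in s -> decomposes V (N x)) ->
  decomposes V (iter_prod s).
Proof.
move=> decB; elim: s => [//|y s IH] dec; apply: decomposes_pair.
  by apply: dec; rewrite mem_head.
by apply: IH => x xs; apply: dec; rewrite inE xs orbT.
Qed.

Lemma indecomposable_retract_iter s M :
  indecomposable B -> (forall x, x \in s -> ~ zero_module (N x)) ->
  (forall x, x \in s -> local_end (N x)) ->
  indecomposable M -> retract M (iter_prod s) ->
  iso_module M B \/ exists2 x, x \in s & iso_module M (N x).
Proof.
move=> Bi; elim: s => [|y s IH] N0 loc Mi.
  by move=> MB; left; apply/iso_sym/retract_indec => //; case: Mi.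
move=> /(exchange (N0 y (mem_head _ _)) (loc y (mem_head _ _)) Mi)[|/IH].
  by right; exists y; rewrite ?mem_head.
case=> // [x xs|x xs||[x xs Mx]].
- by apply: N0; rewrite inE xs orbT.
- by apply: loc; rewrite inE xs orbT.
- by left.
by right; exists x; rewrite // inE xs orbT.
Qed.

End IteratedProduct.

(** * The modules of a flag *)

Lemma lin_comb_comm (B : comPzRingType) (p q u w : B) :
  p * u + q * w = u * p + w * q.
Proof. by rewrite mulrC [q * w]mulrC. Qed.

Lemma sub_rotate (B : comPzRingType) (s p q w : B) :
  s + p + q - w = s - w + p + q.
Proof. by ring. Qed.

Section Flag.
Variables (k : fieldType) (n : nat) (f : 'I_n -> kxy k).
Variable F : seq {set 'I_n}.
Hypothesis f_max : forall i, f i 0%N 0%N = 0.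
Hypothesis f_neq0 : forall i, f i != 0.
Hypothesis flagF : is_flag F.
Hypothesis m_gt0 : (0 < size F)%N.

Local Notation A := (kxy k).
Local Notation R := (Rring f).
Local Notation m := (size F).
Local Notation g := (flag_quot f F).
Local Notation ff := (\prod_i f i).

Lemma fprod_neq0 (I : {set 'I_n}) : fprod f I != 0.
Proof.
apply: (big_ind (fun p : A => p != 0)) => [|p q p0 q0|i _].
- exact: oner_neq0.
- by apply/eqP => /kxy_domain; rewrite (negPf p0) (negPf q0).
- exact: f_neq0.
Qed.

Lemma fprod_max (I : {set 'I_n}) i : i \in I -> (fprod f I) 0%N 0%N = 0.
Proof. by move=> iI; rewrite /fprod (bigD1 i) //= coef00M f_max mul0r. Qed.

Lemma flag_proper j : (j <= m)%N -> flag_set F j \proper flag_set F j.+1.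
Proof.
move=> jm; have /(pathP setT)/(_ j) := flagF.
rewrite size_rcons ltnS -rcons_cons => /(_ jm).
have nthE (s : seq {set 'I_n}) i : nth setT (rcons s setT) i = nth setT s i.
  by rewrite nth_rcons; case: ltngtP => // [lt|->]; rewrite nth_default // ltnW.
by rewrite !nthE.
Qed.

Lemma quot_max j : (0 < j <= m.+1)%N -> (g j) 0%N 0%N = 0.
Proof.
case: j => // j /= jm; have /properP[_ [i iI iN]] := flag_proper jm.
by apply: (@fprod_max _ i); rewrite inE iN iI.
Qed.

Lemma quot_reg j : GRing.lreg (g j).
Proof. by move=> p q; apply: kxyI; apply: fprod_neq0. Qed.

Lemma seg_fprod j : (j <= m.+1)%N -> seg g 0 j = fprod f (flag_set F j).
Proof.
elim: j => [|j IH] jm.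
  by rewrite /seg big_geq // /fprod /flag_set /= big_set0.
rewrite /seg big_nat_recr //= -/(seg g 0 j) IH ?(ltnW jm) // mulrC.
exact: flag_quotE.
Qed.

Lemma seg_total : seg g 0 m.+1 = ff.
Proof.
rewrite seg_fprod // /flag_set /= nth_default // /fprod.
by apply: eq_bigl => i; rewrite inE.
Qed.

Lemma ff_neq0 : ff != 0.
Proof. by rewrite -seg_total seg_fprod // fprod_neq0. Qed.

Lemma ff_max : ff 0%N 0%N = 0.
Proof.
rewrite -seg_total -(@seg_cat _ _ 0 1) // coef00M /seg big_nat1.
by rewrite quot_max ?mul0r.
Qed.

Definition resR : {rmorphism R -> k} :=
  HB.pack (@res k n f)
    (GRing.isZmodMorphism.Build R k (@res k n f) (resB ff_max))
    (GRing.isMonoidMorphism.Build R k (@res k n f)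
       (conj (res1 ff_max) (resM ff_max))).

Local Notation V := (fun a : 'I_m.+1 => vertex f F a).
Local Notation value := (fun a : 'I_m.+1 => @vertex_val k n f F a).

Lemma value_linear (a : 'I_m.+1) (r : R) (z w : V a) :
  value a (r *: z + w) = r * value a z + value a w.
Proof. by case: a z w => -[|j] lt. Qed.

Lemma value_inj (a : 'I_m.+1) : injective (value a).
Proof. by case: a => -[|j] lt z w //=; apply: val_inj. Qed.

Lemma value_image (a : 'I_m.+1) (r : R) : (exists z, value a z = r) <->
  exists p q, r = uR f * p + toR f (seg g 0 a) * q.
Proof.
rewrite seg_fprod; last exact/ltnW/ltn_ord.
case: a => -[|j] lt /=.
  split=> [_|_]; last by exists r.
  by exists 0, r; rewrite /fprod /flag_set /= big_set0 rmorph1 mulr0 add0r mul1r.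
split=> [[z <-]|[p [q ->]]].
  have /ideal2P[p [q zE]] := valP z.
  by exists p, q; apply: etrans zE (lin_comb_comm _ _ _ _).
have zP : ideal_sub [:: uR f; toR f (fprod f (flag_set F j.+1))]
    (uR f * p + toR f (fprod f (flag_set F j.+1)) * q).
  by apply/ideal2P; exists p, q; apply/esym/lin_comb_comm.
by exists (exist (ideal_sub _) _ zP).
Qed.

Lemma vertex_mem I : I \in F -> exists a : 'I_m.+1, Tmod f I = V a.
Proof.
move=> IF; have lt : ((index I F).+1 < m.+1)%N by rewrite ltnS index_mem.
by exists (Ordinal lt); rewrite /= /flag_set /= nth_index.
Qed.

Lemma vertex_retract (a : 'I_m.+1) : retract (V a) (TF f F).
Proof.
case: a => -[|j] lt; first exact: retract_iter_base.
apply: (@retract_iter _ _ (Tmod f) (R^o : lmodType R) F (flag_set F j.+1)).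
by rewrite /flag_set /= mem_nth.
Qed.

Lemma TF_decomposes : decomposes V (TF f F).
Proof.
apply: (@decomposes_iter _ _ (Tmod f) (R^o : lmodType R)); first exact: (decomposes_vertex V ord0).
by move=> I /vertex_mem[a ->]; apply: (decomposes_vertex V a).
Qed.

Lemma TF_exhaustive :
  (forall a, ~ zero_module (V a)) -> (forall a, local_end (V a)) ->
  forall M, indecomposable M -> retract M (TF f F) ->
  exists a, iso_module M (V a).
Proof.
move=> V0 loc M Mi MT.
have Ri := local_indecomposable (V0 ord0) (loc ord0).
have T0 J : J \in F -> ~ zero_module (Tmod f J).
  by move=> /vertex_mem[a ->]; apply: V0.
have Tloc J : J \in F -> local_end (Tmod f J).
  by move=> /vertex_mem[a ->]; apply: loc.
have [MR|[J /vertex_mem[a ->] Ma]] :=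
  indecomposable_retract_iter Ri T0 Tloc Mi MT; last by exists a.
by exists ord0.
Qed.

Lemma in_sq_plusC (p q s : A) : in_sq_plus p q s -> in_sq_plus q p s.
Proof.
move=> [e [e2 /ideal2P[c [d E]]]]; exists e; split=> //.
by apply/ideal2P; exists d, c; rewrite E addrC.
Qed.

Section Loops.
Variable loops : 'I_m.+1 -> seq A.
Hypothesis loopsP : forall a : 'I_m.+1, loops_at f F a (loops a).

Lemma gprev_dvd (a : 'I_m.+1) : exists g', gprev g a * g' = ff.
Proof.
have [b _ [ab <-]] := prev_exists g m_gt0 a; exists (G g a b).
by rewrite G_wrap ?seg_total // eq_sym.
Qed.

(** At the vertex 0 the rule lists the two adjacent factors in the opposite
    order. *)
Lemma loops_basis (a : 'I_m.+1) :
  all (fun t : A => t 0%N 0%N == 0) (loops a) /\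
  forall s : A, s 0%N 0%N = 0 -> exists! c : {ffun 'I_(size (loops a)) -> k},
    in_sq_plus (gprev g a) (gnext g a) (s - \sum_i kC (c i) * (loops a)`_i).
Proof.
have gp0 : (gprev g a) 0%N 0%N = 0.
  rewrite /gprev; case: posnP => a0; apply: quot_max; rewrite ?a0 ?ltnSn //=.
  exact/ltnW/ltn_ord.
have gn0 : (gnext g a) 0%N 0%N = 0 by apply: quot_max; apply: ltn_ord.
have [] : loop_rule (gprev g a) (gnext g a) (loops a) \/
          loop_rule (gnext g a) (gprev g a) (loops a).
  move: (loopsP a); rewrite /loops_at /gprev /gnext.
  by case: (nat_of_ord a) => [|j]; [right|left].
  by move/loop_rule_basis; apply.
move=> /(loop_rule_basis gn0 gp0)[tm basis]; split; [exact: tm|] => s /basis[c [cP cU]].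
exists c; split; first exact: in_sq_plusC.
by move=> d /in_sq_plusC/cU.
Qed.

(** Modulo u and v a scalar of residue 0 is an element s of (x,y), so that
    [loop_sq_descends] reduces the claim to k[[x,y]]. *)
Lemma loops_basis_R (a : 'I_m.+1) rho : resR rho = 0 ->
  exists! c : {ffun 'I_(size (loops a)) -> k},
    loop_sq (toR f) (uR f) (vR f) resR g (kx k) (ky k) a
      (rho - \sum_i kR f (c i) * toR f (loops a)`_i).
Proof.
have [s [r [r' [rhoE s0]]]] := R_split ff_max rho.
move=> r0; have [c [cP cU]] := proj2 (loops_basis a) s (etrans s0 r0).
have [g' g'E] := gprev_dvd a.
have equiv (d : {ffun 'I_(size (loops a)) -> k}) :
    loop_sq (toR f) (uR f) (vR f) resR g (kx k) (ky k) a
      (rho - \sum_i kR f (d i) * toR f (loops a)`_i) <->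
    in_sq_plus (gprev g a) (gnext g a) (s - \sum_i kC (d i) * (loops a)`_i).
  apply: iff_trans (loop_sq_descends ff_max (gnext g a) _ r r' g'E).
  have -> : rho - \sum_i kR f (d i) * toR f (loops a)`_i =
      toR f (s - \sum_i kC (d i) * (loops a)`_i) + uR f * r + vR f * r'.
    rewrite rhoE rmorphB rmorph_sum /=.
    have -> : \sum_i kR f (d i) * toR f (loops a)`_i =
              \sum_i toR f (kC (d i) * (loops a)`_i).
      by apply: eq_bigr => i _; rewrite rmorphM.
    exact: sub_rotate.
  by [].
exists c; split; first exact/equiv.
by move=> d /equiv/cU.
Qed.

Lemma cycle_labels_off (a b : 'I_m.+1) :
  a != b -> cycle_labels f F a b = cycle_arrows (toR f) (uR f) g a b.
Proof.
rewrite /cycle_labels /cycle_arrows /next /G /wrap -val_eqE /=.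
move: (ltn_ord a) (ltn_ord b) => lta ltb ab.
case: (ltngtP a b) ab => // ab _ /=.
  rewrite (_ : (a == m :> nat) && (b == 0%N :> nat) = false); last by lia.
  rewrite (_ : (a == b.+1 :> nat) = false); last by lia.
  rewrite orbF /= cats0 subn0 expr0 expr1 [(b == m :> nat) && _]andbC.
  by case: eqVneq => // ->; rewrite seg_one.
rewrite (_ : (b == a.+1 :> nat) = false); last by lia.
rewrite (_ : (a == 0%N :> nat) && _ = false); last by lia.
rewrite (_ : (b == m :> nat) && _ = false); last by lia.
rewrite orbF /= expr0 expr1; congr (_ ++ _).
by case: eqVneq => // -> /=; case: eqVneq => // ->; rewrite seg_one seg_nil mul1r.
Qed.

Lemma cycle_labels_diag (a : 'I_m.+1) : cycle_labels f F a a = [::].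
Proof.
rewrite /cycle_labels (ltn_eqF (ltnSn a)).
by case: (posnP a) => [->|a0]; rewrite ?eqxx ?andbT ?andbF /= ?(ltn_eqF m_gt0).
Qed.

Lemma flag_quiver :
  exists arr : forall a b : 'I_m.+1,
      'I_(size (labels f loops a b)) -> {linear V a -> V b},
    (forall (a b : 'I_m.+1) (i : 'I_(size (labels f loops a b))),
       multiplies_by (arr a b i) (nth (0, 0) (labels f loops a b) i)) /\
    is_quiver (kR f) (TF f F) arr.
Proof.
apply: (@cyclic_quiver k A R (toR f) (uR f) (vR f) resR (kR f) m g (kx k) (ky k)
  m_gt0 (uR_reg ff_neq0) (res_u ff_max) (res_v ff_max) (@R_unit k n f ff_max)
  (res_kR ff_max) _ _ _ quot_reg _ _ _ _ (fun a : 'I_m.+1 => vertex f F a)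
  (fun a : 'I_m.+1 => @vertex_val k n f F a) value_linear value_inj value_image
  (TF f F) TF_decomposes vertex_retract TF_exhaustive loops (labels f loops)
  _ loops_basis_R).
- exact: res_toR ff_max (kx k).
- exact: res_toR ff_max (ky k).
- move=> z z0; have [s [r [r' [zE s0]]]] := R_split ff_max z.
  have /eqP := etrans s0 z0; rewrite -max_ideal => /ideal2P[p [q sE]].
  exists (toR f p), (toR f q), r, r'; apply: etrans zE _.
  congr (_ + _ + _); rewrite sE; apply: etrans (rmorphD _ _ _) _.
  apply: etrans (congr2 +%R (rmorphM _ _ _) (rmorphM _ _ _)) _.
  exact: lin_comb_comm.
- move=> j jm; apply: etrans (res_toR ff_max (g j)) (quot_max jm).
- by rewrite seg_total; apply: uvR.
- move=> h h' al be; rewrite seg_total => hE h0 h0'.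
  apply: (independence ff_max hE).
  + by apply/eqP => x0; case/eqP: ff_neq0; rewrite -hE x0 mul0r.
  + exact: etrans (esym (res_toR ff_max h)) h0.
  + exact: etrans (esym (res_toR ff_max h')) h0'.
- move=> fa fb fa' fb' w s1 s2 t1 t2; rewrite !seg_total => faE fbE.
  exact: (hom_normal_form ff_neq0 faE fbE).
- move=> a; have [/allP tm _] := loops_basis a; apply/allP => t /tm /eqP t0.
  apply/eqP; exact: etrans (res_toR ff_max t) t0.
- move=> a b ab; rewrite /labels (negPf ab) cats0; exact: cycle_labels_off.
by move=> a; rewrite /labels eqxx cycle_labels_diag.
Qed.

End Loops.
End Flag.

Theorem corollary5p33 (k : fieldType) (n : nat) (f : 'I_n -> kxy k)
    (f_in_xy : forall i, f i \in ideal [:: kx k; ky k])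
    (f_prime : forall i, prime_element (f i))
    (F : seq {set 'I_n}) (flagF : is_flag F) (m_ge1 : (1 <= size F)%N)
    (loops : 'I_(size F).+1 -> seq (kxy k))
    (loopsP : forall a : 'I_(size F).+1, loops_at f F a (loops a)) :
  exists arr : forall a b : 'I_(size F).+1,
      'I_(size (labels f loops a b)) -> {linear vertex f F a -> vertex f F b},
    (forall (a b : 'I_(size F).+1) (i : 'I_(size (labels f loops a b))),
       multiplies_by (arr a b i) (nth (0, 0) (labels f loops a b) i)) /\
    is_quiver (kR f) (TF f F) arr.
Proof.
apply: flag_quiver => // i; last by apply/eqP; case: (f_prime i).
by apply/eqP; rewrite -max_ideal.
Qed.
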